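(* Take any $n\ge 5$. Suppose that $K$ and $\widetilde K$ are two norms on $\mathbb{R}^n$ and $Y\sim N_n(\mu,\sigma^2 I_n)$ for some $\mu\in\mathbb{R}^n$ and $\sigma>0$. Let $Z\sim N_n(0,I_n)$ be defined on the same probability space as $Y$. Define \[ \hat\sigma := \frac{\widetilde K(Y)}{\widetilde K(Z)} \] and \[ \hat\mu := \operatorname{argmin}\{K(\nu): \nu\in\mathbb{R}^n,\ \|Y-\nu\|^2\le n\hat\sigma^2\}. \] For each $k\ge 1$, let $m_k := \bigl(\mathbb{E}(\widetilde K^\circ(Z)^k)\bigr)^{1/k}$, where $\widetilde K^\circ$ is the dual norm of $\widetilde K$. Let \[ a := \sup\{\|v\| : v\in\mathbb{R}^n,\ \widetilde K^\circ(v)\le 1\}. \] Then \begin{align*} \frac{\mathbb{E}\|\hat\mu-\mu\|^2}{n\sigma^2} &\le \frac{16}{n\sigma}K(\mu)\,\mathbb{E}(K^\circ(Z)) + 2\sqrt{\frac{2}{n}} + \frac{2\widetilde K(\mu)^2m_2^2}{(n-2)^2\sigma^2}\\ &\qquad + \frac{64\sqrt{2}\,a^2m_4^2}{(n-4)^2} + \frac{4\widetilde K(\mu)m_2}{(n-2)\sigma} + \frac{28\,a\,m_4}{n-4}, \end{align*} where $K^\circ$ is the dual norm of $K$.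
   Context: $\|\cdot\|$ is the Euclidean norm on $\mathbb{R}^n$ and $x\cdot y$ is the standard inner product. $N_n(\mu,\sigma^2 I_n)$ denotes the $n$-dimensional Gaussian distribution with mean vector $\mu$ and covariance matrix $\sigma^2 I_n$, where $I_n$ is the $n\times n$ identity matrix. The dual norm of a norm $K$ on $\mathbb{R}^n$ is $K^\circ(x)=\sup_{y\ne 0}\frac{x\cdot y}{K(y)}$. *)

(* Defs.v *)
From HB Require Import structures.
From mathcomp Require Import all_boot all_order all_algebra.
From mathcomp Require Import all_classical all_reals all_analysis.
Import Order.TTheory GRing.Theory Num.Theory.
Import numFieldNormedType.Exports.

Set Implicit Arguments.
Unset Strict Implicit.
Unset Printing Implicit Defensive.

Local Open Scope classical_set_scope.
Local Open Scope ring_scope.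

Definition dot (R : realType) (n : nat) (x y : 'rV[R]_n) : R :=
  \sum_(i < n) x 0 i * y 0 i.

(* The norm [`|x|] that the library puts on ['rV[R]_n] is the max norm. *)
Definition enorm (R : realType) (n : nat) (x : 'rV[R]_n) : R :=
  Num.sqrt (dot x x).

Definition is_norm (R : realType) (n : nat) (K : 'rV[R]_n -> R) : Prop :=
  [/\ forall x, 0 <= K x,
      forall x, K x = 0 -> x = 0,
      forall (c : R) x, K (c *: x) = `|c| * K x
    & forall x y, K (x + y) <= K x + K y].

Definition dual_norm (R : realType) (n : nat) (K : 'rV[R]_n -> R)
    (x : 'rV[R]_n) : R :=
  sup [set dot x y / K y | y in [set y | y != 0]].

Definition is_borel (R : realType) (n : nat) : set (set 'rV[R]_n) :=
  <<s [set U : set 'rV[R]_n | open U] >>.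
Arguments is_borel : clear implicits.

(* Integral over R^n with respect to n-dimensional Lebesgue measure, as an
   iterated one-dimensional Lebesgue integral; by Tonelli's theorem the order of
   the coordinates does not matter for nonnegative Borel integrands. *)
Fixpoint lebesgue_int (R : realType) (n : nat) :
    ('rV[R]_n -> \bar R) -> \bar R :=
  match n with
  | 0 => fun f => f 0
  | n'.+1 => fun f => (\int[lebesgue_measure]_x
      lebesgue_int (fun v : 'rV[R]_n' => f (row_mx (x%:M : 'rV[R]_1) v)))%E
  end.

Definition gaussian_pdf (R : realType) (n : nat) (mu : 'rV[R]_n)
    (Sigma : 'M[R]_n) (x : 'rV[R]_n) : R :=
  expR (- ((x - mu) *m invmx Sigma *m (x - mu)^T) 0 0 / 2) /
  Num.sqrt ((2 * pi) ^+ n * \det Sigma).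

(* [X] is a random vector with law N_n(mu, Sigma), for [Sigma] symmetric
   positive definite. *)
Definition has_gaussian_law (R : realType) (d : measure_display)
    (T : measurableType d) (P : probability T R) (n : nat) (X : T -> 'rV[R]_n)
    (mu : 'rV[R]_n) (Sigma : 'M[R]_n) : Prop :=
  forall A, is_borel R n A ->
    measurable (X @^-1` A) /\
    P (X @^-1` A) =
      lebesgue_int (fun x => (gaussian_pdf mu Sigma x * \1_A x)%:E).

Definition argmin_on (R : realType) (n : nat) (K : 'rV[R]_n -> R)
    (S : set 'rV[R]_n) : set 'rV[R]_n :=
  [set nu | S nu /\ forall nu', S nu' -> K nu <= K nu'].

(* The value is 0 on the event [Kt z = 0], which is negligible when z is
   drawn from a standard Gaussian law. *)
Definition sigma_hat (R : realType) (n : nat) (Kt : 'rV[R]_n -> R)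
    (y z : 'rV[R]_n) : R := Kt y / Kt z.

(* A norm has exactly one minimizer on a closed Euclidean ball (which is
   strictly convex), so [get] returns the argmin. *)
Definition mu_hat (R : realType) (n : nat) (K Kt : 'rV[R]_n -> R)
    (y z : 'rV[R]_n) : 'rV[R]_n :=
  get (argmin_on K
    [set nu | enorm (y - nu) ^+ 2 <= n%:R * sigma_hat Kt y z ^+ 2]).

Definition dual_moment (R : realType) (d : measure_display)
    (T : measurableType d) (P : probability T R) (n : nat)
    (Kt : 'rV[R]_n -> R) (Z : T -> 'rV[R]_n) (k : nat) : \bar R :=
  ('E_P[fun w => (dual_norm Kt (Z w) ^+ k)%R] `^ (k%:R^-1)%R)%E.

Definition dual_ball_radius (R : realType) (n : nat) (Kt : 'rV[R]_n -> R) : R :=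
  sup [set enorm v | v in [set v | dual_norm Kt v <= 1]].

(* Main.v *)
Require Import Defs.
From HB Require Import structures.
From mathcomp Require Import all_boot all_order all_algebra.
From mathcomp Require Import all_classical all_reals all_analysis.
From mathcomp Require Import measurable_realfun ring lra.
Import Order.TTheory GRing.Theory Num.Theory.
Import numFieldNormedType.Exports.

Set Implicit Arguments.
Unset Strict Implicit.
Unset Printing Implicit Defensive.

Local Open Scope classical_set_scope.
Local Open Scope ring_scope.

(* Put W = (Y - mu) / sigma, so that W and Z are standard Gaussian, with an
   arbitrary joint law.

   Deterministic part: if K(mu_hat) <= K(mu), expanding the square around Y and
   duality give |mu_hat - mu|^2 <= n sigma_hat^2 - |Y - mu|^2
   + 4 K(mu) K^o(Y - mu); otherwise mu_hat is the projection of Y on the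
   sublevel set of K through it, and |mu_hat - mu|^2 <= |Y - mu|^2 - n sigma_hat^2.
   This leaves E ||W|^2 - n| <= sqrt(2 n) and E |sigma_hat^2 / sigma^2 - 1|, and
   |sigma_hat / sigma - 1| <= (Kt(mu) / sigma + |Kt(W) - Kt(Z)|) / Kt(Z).

   Negative moments: 1 / Kt(z) <= Kt^o(z) / |z|^2, and negative powers of |z|
   are removed by the identity E[G |Z|^2] = (n + j) E[G] for G homogeneous of
   degree j, which follows from the scaling of the Gaussian density.

   Concentration: Kt is a-Lipschitz, and Maurey's property (tau) gives
   E exp((Kt(W) - M)_+^2 / (4 a^2)) <= 2 at a median M, hence a dimension-free
   bound on E (Kt(W) - M)^4.

   Since W and Z may be dependent, products are split pointwise by the AM-GM
   inequality with tuned weights before taking expectations. *)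

(** * Integration and Borel sets of row vectors *)

(** The obstacle is that Y and Z may be coupled in any way, so the mean of |Kt(W) - Kt(Z)| / Kt(Z)
    cannot be factored. Both norms are centred at one median M, which depends only on their common
    law; two fourth central moments and a fourth negative moment of Kt(Z) then appear separately.
    This fourth power is the source of m_4, of n - 4 and of n >= 5. Each AM-GM weight minimises,
    exactly or up to rounding, the bound that it produces, so essentially nothing is lost against
    Cauchy-Schwarz.

    The law hypotheses speak of iterated Lebesgue integrals of a density. They are converted once
    into integrals against a measure [gauss] built coordinate by coordinate, for which Tonelli and
    induction on n are at hand. The estimator [mu_hat] itself is never shown to be measurable: it
    enters only through a pointwise bound by a measurable function, and monotonicity of the integral
    of nonnegative functions does the rest. *)

Section density.
Local Open Scope ereal_scope.
Context d (T : measurableType d) (R : realType).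
Variables (m nu : {measure set T -> \bar R}) (p : T -> R).
Hypothesis mp : measurable_fun setT p.
Hypothesis p0 : forall x, (0 <= p x)%R.
Hypothesis nuE : forall A, measurable A -> nu A = \int[m]_(x in A) (p x)%:E.

Import HBNNSimple.

Let mpe : measurable_fun setT (fun x => (p x)%:E). Proof.
  exact/measurable_EFinP. Qed.

Let density_nnsfun (f : {nnsfun T >-> R}) :
  \int[nu]_x (f x)%:E = \int[m]_x ((p x)%:E * (f x)%:E).
Proof.
under [LHS]eq_integral do rewrite fimfunE -fsumEFin//.
rewrite [LHS]ge0_integral_fsum//; last 2 first.
  - by move=> r; exact/measurable_EFinP/measurableT_comp.
  - by move=> n x _; rewrite EFinM nnfun_muleindic_ge0.
under [RHS]eq_integral.
  move=> x xD; rewrite fimfunE -fsumEFin// ge0_mule_fsumr; last first.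
    by move=> r; rewrite EFinM nnfun_muleindic_ge0.
  over.
rewrite [RHS]ge0_integral_fsum//; last 2 first.
  - move=> r; apply: emeasurable_funM => //.
    by apply/measurable_EFinP; do 2 apply/measurableT_comp => //.
  - move=> n x _; rewrite EFinM mule_ge0//; first by rewrite lee_fin.
    by rewrite nnfun_muleindic_ge0.
apply: eq_fsbigr => r _.
rewrite integralZl_indic_nnsfun// integral_indic// setIT nuE//.
have [r0|r0] := leP 0%R r; last first.
  have E0 : f @^-1` [set r] = set0.
    apply/seteqP; split => // x /= fx; have : (0 <= f x)%R by [].
    by rewrite fx leNgt r0.
  rewrite E0 integral_set0 mule0 integral0_eq// => x _.
  by rewrite indic0 mulr0 mule0.
under [RHS]eq_integral => x _ do rewrite EFinM muleCA.
rewrite ge0_integralZl//=.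
- congr (_ * _); rewrite integral_mkcond; apply: eq_integral => x _.
  by rewrite epatch_indic.
- apply: emeasurable_funM => //; apply/measurable_EFinP/measurable_indic.
  exact: measurable_sfunP.
- by move=> x _; rewrite mule_ge0 ?lee_fin.
Qed.

(** The relation between [nu] and [p] is assumed on sets; it passes to simple functions by linearity
    and to nonnegative functions by monotone convergence. Its use is for [normal_prob]. *)
Lemma ge0_integral_density (f : T -> \bar R) :
  measurable_fun setT f -> (forall x, 0 <= f x) ->
  \int[nu]_x f x = \int[m]_x ((p x)%:E * f x).
Proof.
move=> mf f0; pose f_ := nnsfun_approx measurableT mf.
transitivity (limn (fun n => \int[nu]_x (f_ n x)%:E)).
  rewrite -monotone_convergence//=.
  - apply: eq_integral => ? /[!inE] xD; apply/esym/cvg_lim => //=.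
    exact: cvg_nnsfun_approx.
  - by move=> n; exact/measurable_EFinP/measurable_funTS.
  - by move=> n ? _; rewrite lee_fin.
  - by move=> ? _ ? ? mn; rewrite lee_fin; exact/lefP/nd_nnsfun_approx.
transitivity (limn (fun n => \int[m]_x ((p x)%:E * (f_ n x)%:E))).
  by congr (limn _); apply/funext => n; exact: density_nnsfun.
rewrite -monotone_convergence//=.
- apply: eq_integral => x /[!inE] xD; apply/cvg_lim => //=.
  by apply: cvgeZl => //; exact: cvg_nnsfun_approx.
- move=> n; apply: emeasurable_funM => //.
  exact/measurable_EFinP/measurable_funTS.
- by move=> n x _; rewrite mule_ge0 ?lee_fin.
- move=> x _ a b ab; rewrite lee_pmul ?lee_fin//.
  exact/lefP/nd_nnsfun_approx.
Qed.

End density.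

Section le_integral_nonmeasurable.
Local Open Scope ereal_scope.
Context d (T : measurableType d) (R : realType).
Variable m : {measure set T -> \bar R}.

(* The integral of a nonnegative function is a supremum over simple minorants,
   so it is monotone even without measurability. *)
Lemma ge0_le_integral_nonmeasurable (f g : T -> \bar R) :
  (forall x, 0 <= f x) -> (forall x, f x <= g x) ->
  \int[m]_x f x <= \int[m]_x g x.
Proof.
move=> f0 fg.
have g0 x : 0 <= g x := le_trans (f0 x) (fg x).
rewrite !ge0_integralTE//; apply: le_ereal_sup => _ [h hf <-].
by exists h => // x; exact: le_trans (hf x) (fg x).
Qed.

End le_integral_nonmeasurable.

(** A copy of the row vectors carrying the sigma-algebra of [is_borel], so that [measurable_fun]
    refers to the same sets as [has_gaussian_law]. *)
Definition borel (R : realType) n : Type :=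
  g_sigma_algebraType [set U : set 'rV[R]_n | open U].

HB.instance Definition _ (R : realType) n :=
  Measurable.copy (borel R n)
    (g_sigma_algebraType [set U : set 'rV[R]_n | open U]).

Section borel_measurability.
Context (R : realType).

Lemma continuous_borel n (f : 'rV[R]_n -> R) :
  continuous f -> measurable_fun setT (f : borel R n -> R).
Proof.
move=> cf; apply: (measurability _ (RGenOpens.measurableE R)).
move=> _ [_ [a [b ->] <-]]; rewrite setTI; apply: sub_sigma_algebra => /=.
by apply: open_comp => // x _; exact: cf.
Qed.

Lemma continuous_borel_borel n k (f : 'rV[R]_n -> 'rV[R]_k) :
  continuous f -> measurable_fun setT (f : borel R n -> borel R k).
Proof.
move=> cf; apply: (measurability [set U : set (borel R _) | open (U : set
  (matrix R _ _))] erefl) => _ [U /= oU <-].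
rewrite setTI; apply: sub_sigma_algebra => /=.
by apply: open_comp => // x _; exact: cf.
Qed.

Lemma continuous_affine_row n (mu : 'rV[R]_n) (s : R) :
  continuous (fun v : 'rV[R]_n => mu + s *: v).
Proof.
move=> x; apply: continuousD; first exact: cst_continuous.
exact: scaler_continuous.
Qed.

Lemma measurable_affine_row n (mu : 'rV[R]_n) (s : R) :
  measurable_fun setT ((fun v => mu + s *: v) : borel R n -> borel R n).
Proof. by apply: continuous_borel_borel; exact: continuous_affine_row. Qed.

Definition cons_row n (xv : measurableTypeR R * borel R n) : borel R n.+1 :=
  row_mx (xv.1%:M : 'rV[R]_1) (xv.2 : 'rV[R]_n).

Lemma cons_row0 n x (v : 'rV[R]_n) : (cons_row (x, v) : 'rV_n.+1) 0 0 = x.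
Proof.
rewrite /cons_row; have -> : (0 : 'I_n.+1) =
  lshift n (0 : 'I_1) by exact/val_inj.
by rewrite (@row_mxEl _ _ 1) mxE eqxx.
Qed.

Lemma cons_rowS n x (v : 'rV[R]_n) i :
  (cons_row (x, v) : 'rV_n.+1) 0 (lift ord0 i) = v 0 i.
Proof. by rewrite /cons_row -rshift1 (@row_mxEr _ _ 1). Qed.

Lemma affine_cons_row n (mu : 'rV[R]_n.+1) (s x : R) (v : 'rV[R]_n) :
  mu + s *: (cons_row (x, v) : 'rV[R]_n.+1) =
  cons_row (mu 0 0 + s * x, \row_i mu 0 (lift ord0 i) + s *: v).
Proof.
apply/rowP => i; have [->|[j ->]] : i = 0 \/ exists j, i = lift ord0 j.
  by case: (unliftP ord0 i) => [j ->|->]; [right; exists j|left].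
- by rewrite cons_row0 2!mxE cons_row0.
- by rewrite cons_rowS 2!mxE cons_rowS !mxE.
Qed.

(* Every open set is the union of the rational open boxes that it contains, and
   the preimage of a box under [cons_row] is a rectangle. *)
Lemma measurable_cons_row n : measurable_fun setT (@cons_row n).
Proof.
apply: (measurability [set U : set (borel R _) | open (U : set (matrix R _
  _))] erefl) => _ [U /= oU <-]; rewrite setTI.
pose box k (q : 'rV[rat]_k * 'rV[rat]_k) : set 'rV[R]_k :=
  [set x | forall i, ratr (q.1 0 i) < x 0 i < ratr (q.2 0 i)].
have obox k q : open (box k q).
  rewrite openE => x /= bx.
  exists (fun i j => [set y | ratr (q.1 0 j) < y < ratr (q.2 0 j)]).
    move=> i j; rewrite ord1.
    have /andP[b1 b2] := bx j.
    by apply: filterS2 (lt_nbhsr b1) (lt_nbhsl b2) => y /= -> ->.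
  by move=> y yb i; exact: yb.
have UE : U = \bigcup_(q in [set q | box n.+1 q `<=` U]) box n.+1 q.
  apply/seteqP; split; last by move=> x [q /= qU] /qU.
  move=> x Ux.
  have /nbhs_ballP[e /= e0 xeU] : nbhs x U by move: oU; rewrite openE; exact.
  have ratE i : exists q : rat * rat,
      [/\ x 0 i - e < ratr q.1, ratr q.1 < x 0 i, x 0 i < ratr q.2
        & ratr q.2 < x 0 i + e].
    have lt1 : x 0 i - e < x 0 i by rewrite ltrBlDr ltrDl.
    have lt2 : x 0 i < x 0 i + e by rewrite ltrDl.
    have [q1] := rat_in_itvoo lt1; rewrite in_itv/= => /andP[q11 q12].
    have [q2] := rat_in_itvoo lt2; rewrite in_itv/= => /andP[q21 q22].
    by exists (q1, q2).
  have [f Pf] := choice ratE.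
  exists (\row_i (f i).1, \row_i (f i).2); last first.
    by move=> i /=; rewrite !mxE; have [_ -> -> _] := Pf i.
  move=> y /= yb; apply: xeU; split => // i j; rewrite ord1.
  have := yb j; rewrite !mxE /ball/= => /andP[y1 y2].
  have [f1 f2 f3 f4] := Pf j.
  by rewrite ltr_norml; apply/andP; split; lra.
rewrite UE preimage_bigcup bigcup_mkcond.
apply: countable_bigcupT_measurable => // q; case: ifP => // _.
rewrite (_ : _ @^-1` _ =
    `]ratr (q.1 0 0), ratr (q.2 0 0)[%classic `*`
    (box n (\row_i q.1 0 (lift ord0 i),
      \row_i q.2 0 (lift ord0 i)) : set (borel R n))).
  apply: measurableX; first exact: measurable_itv.
  by apply: sub_sigma_algebra; exact: obox.
apply/seteqP; split => [[x v] /= H|[x v] /= [H1 H2] i].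
  split; first by have := H 0; rewrite cons_row0 in_itv.
  by move=> i; have := H (lift ord0 i); rewrite cons_rowS !mxE.
have [->|[j ->]] : i = 0 \/ exists j, i = lift ord0 j.
    by case: (unliftP ord0 i) => [j ->|->]; [right; exists j|left].
  by move: H1; rewrite cons_row0 in_itv.
by have := H2 j; rewrite cons_rowS !mxE.
Qed.

End borel_measurability.

(** * The standard Gaussian measure *)

Section gaussian_measure.
Context (R : realType).
Local Open Scope ereal_scope.

HB.instance Definition _ n :=
  isMeasurableFun.Build _ _ _ _ (@cons_row R n) (@measurable_cons_row R n).

(** The recursion follows that of [lebesgue_int], so the two can be compared one coordinate at a
    time. *)
Fixpoint gauss n : probability (borel R n) R :=
  match n with
  | 0 => dirac ((0%R : 'rV[R]_0) : borel R 0)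
  | k.+1 => distribution (normal_prob 0%R 1%R \x gauss k) (@cons_row R k)
  end.

Lemma integral_gauss0 (f : borel R 0 -> \bar R) :
  measurable_fun setT f -> \int[gauss 0]_x f x = f 0%R.
Proof. by move=> mf; rewrite integral_dirac// diracT mul1e. Qed.

Lemma ge0_integral_gaussS n (f : borel R n.+1 -> \bar R) :
  measurable_fun setT f -> (forall x, 0 <= f x) ->
  \int[gauss n.+1]_x f x =
  \int[normal_prob 0%R 1%R]_x \int[gauss n]_v f (cons_row (x, v)).
Proof.
move=> mf f0; rewrite ge0_integral_distribution// fubini_tonelli1//; last first.
  by move=> x; exact: f0.
by apply: measurableT_comp => //; exact: measurable_cons_row.
Qed.

Lemma measurable_integral_gauss n (f : borel R n.+1 -> \bar R) :
  measurable_fun setT f -> (forall x, 0 <= f x) ->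
  measurable_fun setT (fun x => \int[gauss n]_v f (cons_row (x, v))).
Proof.
move=> mf f0; apply: (measurable_fun_fubini_tonelli_F (f \o @cons_row R n));
  last by move=> x; exact: f0.
by apply: measurableT_comp => //; exact: measurable_cons_row.
Qed.

Lemma measurable_cons_row1 n (x : R) :
  measurable_fun setT (fun v : borel R n => cons_row (x, v)).
Proof.
by apply: measurableT_comp;
  [exact: measurable_cons_row|exact: measurable_pair1].
Qed.

Lemma ge0_integral_normal_prob (m s : R) (f : R -> \bar R) :
  measurable_fun setT f -> (forall x, 0 <= f x) ->
  \int[normal_prob m s]_x f x =
  \int[lebesgue_measure]_x ((normal_pdf m s x)%:E * f x).
Proof.
move=> mf f0; apply: ge0_integral_density => //.
- exact: measurable_normal_pdf.
- exact: normal_pdf_ge0.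
Qed.

Let affine (m s : R) (x : measurableTypeR R) : measurableTypeR R :=
  (m + s * x)%R.

Let measurable_affine m s : measurable_fun setT (affine m s).
Proof. by apply: measurable_funD => //; exact: measurable_funM. Qed.

(** The pushforward of Lebesgue measure under the affine map, multiplied by [s], has the right value
    on half-open intervals, hence is Lebesgue measure by uniqueness. *)
Lemma ge0_integral_lebesgue_affine (m s : R) (f : R -> \bar R) : (0 < s)%R ->
  measurable_fun setT f -> (forall x, 0 <= f x) ->
  \int[lebesgue_measure]_x f x =
  s%:E * \int[lebesgue_measure]_x f (m + s * x)%R.
Proof.
move=> s0 mf f0.
pose nu_ := mscale (NngNum (ltW s0))
  (pushforward (@lebesgue_measure R) (affine m s)).
pose nu := nu_ (measurable_affine m s).
have nuE A : measurable A -> lebesgue_measure A = nu A.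
  apply: lebesgue_measure_unique => _ [[a b]] _ <-.
  change (lebesgue_measure (`]a, b]%classic : set (measurableTypeR R)) =
    s%:E * lebesgue_measure (affine m s @^-1` `]a, b]%classic)).
  rewrite (_ : _ @^-1` _ = `]((a - m) / s)%R, ((b - m) / s)%R]%classic);
    last first.
    apply/seteqP; split => x /=; rewrite !in_itv/= /affine;
      by rewrite ltr_pdivrMr// ler_pdivlMr// ltrBlDl lerBrDl (mulrC s).
  rewrite !lebesgue_measure_itv/= !lte_fin ltr_pM2r ?invr_gt0// ltrBDr subrK.
  case: ifP => _; last by rewrite mule0.
  by rewrite -EFinB -EFinM; congr _%:E; field; rewrite gt_eqF.
rewrite (eq_measure_integral nu) => [|A mA _]; last exact: nuE.
by rewrite ge0_integral_mscale// ge0_integral_pushforward.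
Qed.

Lemma normal_pdf_affine (m s x : R) : (0 < s)%R ->
  normal_pdf m s (m + s * x) = (s^-1 * normal_pdf 0 1 x)%R.
Proof.
move=> s0; rewrite !normal_pdfE ?gt_eqF//.
rewrite /normal_peak /normal_fun mulrA; congr (_ * expR _)%R.
  rewrite expr1n mul1r -mulrnAr sqrtrM ?sqr_ge0// sqrtr_sqr gtr0_norm//.
  by rewrite invfM.
by field; rewrite gt_eqF.
Qed.

Lemma ge0_integral_normal_pdf (m s : R) (f : R -> \bar R) : (0 < s)%R ->
  measurable_fun setT f -> (forall x, 0 <= f x) ->
  \int[lebesgue_measure]_x ((normal_pdf m s x)%:E * f x) =
  \int[normal_prob 0%R 1%R]_x f (m + s * x)%R.
Proof.
move=> s0 mf f0.
have mfa : measurable_fun setT (fun x => f (m + s * x)%R).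
  by apply: (measurableT_comp mf); exact: measurable_affine.
have mp : measurable_fun setT (fun x => (normal_pdf m s x)%:E * f x).
  apply: emeasurable_funM => //; apply/measurable_EFinP.
  exact: measurable_normal_pdf.
have p0 x : 0 <= (normal_pdf m s x)%:E * f x.
  by rewrite mule_ge0// lee_fin normal_pdf_ge0.
rewrite (ge0_integral_normal_prob 0%R 1%R mfa (fun x => f0 _)).
rewrite (ge0_integral_lebesgue_affine m s0 mp p0) -ge0_integralZl//.
- apply: eq_integral => x _; rewrite normal_pdf_affine// muleA -EFinM.
  by rewrite mulrA divff ?gt_eqF// mul1r.
- by apply: (measurableT_comp mp); exact: measurable_affine.
- by rewrite lee_fin ltW.
Qed.

Lemma gaussian_pdf_prod n (mu x : 'rV[R]_n) (s : R) : (0 < s)%R ->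
  gaussian_pdf mu (s ^+ 2)%:M x = (\prod_i normal_pdf (mu 0 i) s (x 0 i))%R.
Proof.
move=> s0; under eq_bigr do rewrite normal_pdfE ?gt_eqF//.
rewrite big_split/= mulrC /gaussian_pdf; congr (_ * _)%R.
  rewrite /normal_fun -expR_sum; congr expR.
  rewrite invmx_scalar mul_mx_scalar -scalemxAl mxE mulNr.
  rewrite mxE mulr_sumr mulr_suml -sumrN; apply: eq_bigr => i _.
  by rewrite !mxE; field; rewrite gt_eqF.
rewrite /normal_peak prodr_const card_ord det_scalar -exprMn exprVn.
congr (_ ^-1)%R.
elim: n {mu x} => [|n IH]; first by rewrite !expr0 sqrtr1.
rewrite !(exprS _ n) sqrtrM ?IH;
  last by rewrite mulr_ge0 ?sqr_ge0// mulr_ge0 ?pi_ge0.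
by congr (Num.sqrt _ * _)%R; ring.
Qed.

(** The covariance is scalar, so the density factors over the coordinates. The constant [c] is there
    for the induction: it collects the densities of the outer coordinates, which stay fixed while
    the inner ones are integrated. *)
Lemma lebesgue_int_gaussian n (mu : 'rV[R]_n) (s c : R) (f : borel R n ->
  \bar R) :
  (0 < s)%R -> (0 <= c)%R -> measurable_fun setT f -> (forall x, 0 <= f x) ->
  lebesgue_int (fun x => (c * gaussian_pdf mu (s ^+ 2)%:M x)%:E * f x) =
  c%:E * \int[gauss n]_x f ((mu : 'rV_n) + s *: (x : 'rV_n))%R.
Proof.
move=> s0; elim: n mu c f => [mu c f c0 mf f0|n IH mu c f c0 mf f0].
  rewrite /= gaussian_pdf_prod// big_ord0 mulr1.
  rewrite integral_gauss0; last first.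
    by apply: (measurableT_comp mf); exact: measurable_affine_row.
  by congr (_ * f _); apply/rowP => -[].
have mfa : measurable_fun setT
    (fun x : borel R n.+1 => f ((mu : 'rV_n.+1) + s *: (x : 'rV_n.+1))%R).
  by apply: (measurableT_comp mf); exact: measurable_affine_row.
rewrite ge0_integral_gaussS// /=.
pose muT : 'rV[R]_n := (\row_i mu 0 (lift ord0 i))%R.
pose g (x : R) : \bar R := \int[gauss n]_v f (cons_row (x,
  (muT : 'rV_n) + s *: (v : 'rV_n))%R).
transitivity (\int[lebesgue_measure]_x ((normal_pdf (mu 0 0)%R s x)%:E * (c%:E
  * g x))).
  apply: eq_integral => x _.
  have cp0 : (0 <= c * normal_pdf (mu 0 0) s x)%R by rewrite mulr_ge0
    ?normal_pdf_ge0.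
  have mfx : measurable_fun setT (fun v : borel R n => f (cons_row (x, v))).
    by apply: (measurableT_comp mf); exact: measurable_cons_row1.
  rewrite muleA -EFinM (mulrC _ c) /g -(IH muT _ _ cp0 mfx (fun v => f0 _)).
  congr (lebesgue_int _); apply/funext => v.
  congr (_%:E * _); rewrite !gaussian_pdf_prod// big_ord_recl -mulrA.
  rewrite cons_row0; congr (c * (_ * _))%R.
  by apply: eq_bigr => i _; rewrite cons_rowS mxE.
have mg : measurable_fun setT g.
  apply: (measurable_fun_fubini_tonelli_F
    (fun xv : measurableTypeR R * borel R n => f (cons_row (xv.1,
      (muT : 'rV_n) + s *: (xv.2 : 'rV_n))%R))); last by move=> x; exact: f0.
  apply: (measurableT_comp mf).
  apply: (measurableT_comp (@measurable_cons_row R n)).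
  apply: measurable_fun_pair => /=; first exact: measurable_fst.
  exact: (measurableT_comp (measurable_affine_row muT s) measurable_snd).
have g0 x : 0 <= g x by apply: integral_ge0.
have gE : \int[normal_prob 0%R 1%R]_x g (mu 0 0 + s * x)%R =
    \int[normal_prob 0%R 1%R]_x
      \int[gauss n]_v f ((mu : 'rV_n.+1) + s *: (cons_row (x, v) : 'rV_n.+1))%R.
  apply: eq_integral => x _; apply: eq_integral => v _.
  by rewrite affine_cons_row.
rewrite -gE; move: (g) mg g0 => {gE}g mg g0.
rewrite (@ge0_integral_normal_pdf (mu 0 0)%R s (fun x => c%:E * g x))//;
  last 2 first.
- exact: emeasurable_funM.
- by move=> x; rewrite mule_ge0.
by rewrite ge0_integralZl//; apply: (measurableT_comp mg);
  exact: measurable_affine.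
Qed.

End gaussian_measure.

Section gaussian_law.
Context (R : realType) d (T : measurableType d) (P : probability T R) (n : nat).
Context (X : T -> 'rV[R]_n) (mu : 'rV[R]_n) (s : R).
Hypotheses (s0 : 0 < s) (lawX : has_gaussian_law P X mu (s ^+ 2)%:M).
Local Open Scope ereal_scope.

Definition standardize (w : T) : borel R n := (s^-1 *: (X w - mu))%R.

Let measurable_X : measurable_fun setT (X : T -> borel R n).
Proof. by move=> _ A mA; rewrite setTI; have [] := lawX mA. Qed.

Let standardizing (x : borel R n) : borel R n := (s^-1 *: ((x : 'rV_n) - mu))%R.

Let measurable_standardizing : measurable_fun setT standardizing.
Proof.
rewrite (_ : standardizing = (fun v => - (s^-1 *: mu) + s^-1 *: v)%R).
  exact: measurable_affine_row.
by apply/funext => v; rewrite /standardizing scalerBr addrC.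
Qed.

Lemma measurable_standardize : measurable_fun setT standardize.
Proof. exact: (measurableT_comp measurable_standardizing measurable_X). Qed.

(** The law hypothesis says that the image of [P] under [X] and the image of [gauss] under
    [x |-> mu + s x] agree on Borel sets; the rest is a change of variables on each side. *)
Lemma ge0_integral_standardize (f : borel R n -> \bar R) :
  measurable_fun setT f -> (forall x, 0 <= f x) ->
  \int[P]_w f (standardize w) = \int[gauss R n]_x f x.
Proof.
move=> mf f0.
pose aff (x : borel R n) : borel R n := ((mu : 'rV_n) + s *: (x : 'rV_n))%R.
have maff : measurable_fun setT aff by exact: measurable_affine_row.
have mfs : measurable_fun setT (f \o standardizing).
  exact: (measurableT_comp mf measurable_standardizing).
transitivity (\int[pushforward P (X : T ->
  borel R n)]_y (f \o standardizing) y).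
  by rewrite ge0_integral_pushforward// => y _; exact: f0.
transitivity (\int[pushforward (gauss R n) aff]_y (f \o standardizing) y).
  apply: eq_measure_integral => /= A mA _; rewrite /pushforward.
  have [_ ->] := lawX mA.
  transitivity (lebesgue_int
      (fun x => (1 * gaussian_pdf mu (s ^+ 2)%:M x)%:E * (\1_A x)%:E)).
    by congr lebesgue_int; apply/funext => x; rewrite mul1r EFinM.
  rewrite (@lebesgue_int_gaussian _ _ _ _ _ (EFin \o \1_A))//; last 2 first.
  - exact/measurable_EFinP/measurable_indic.
  - by move=> x; rewrite lee_fin.
  rewrite mul1e -[aff @^-1` A]setIT -integral_indic//.
  by rewrite -[aff @^-1` A]setTI; exact: maff.
rewrite ge0_integral_pushforward//; last by move=> y _; exact: f0.
apply: eq_integral => x _ /=; congr f.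
by rewrite /standardizing /aff addrC addKr scalerA mulVf ?gt_eqF// scale1r.
Qed.

End gaussian_law.

(** * Scaling of the standard Gaussian measure *)

Section gaussian_scaling.
Context (R : realType) (n : nat).
Local Open Scope ereal_scope.

Lemma continuous_dot_self : continuous (fun x : 'rV[R]_n => dot x x).
Proof.
apply: continuous_big => [|i _ x]; first exact: add_continuous.
have ci := @coord_continuous R 1 n 0%R i x.
exact: (continuousM ci ci).
Qed.

Lemma measurable_dot_self : measurable_fun setT (fun x : borel R n => dot x x).
Proof. by apply: continuous_borel; exact: continuous_dot_self. Qed.

Lemma dot_self_ge0 (x : 'rV[R]_n) : (0 <= dot x x)%R.
Proof. by apply: sumr_ge0 => i _; rewrite -expr2 sqr_ge0. Qed.

Lemma gaussian_pdf_scale (r : R) (x : 'rV[R]_n) : (0 < r)%R ->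
  gaussian_pdf 0 (r^-1 ^+ 2)%:M x =
  (r ^+ n * expR (- ((r ^+ 2 - 1) * dot x x / 2)) *
   gaussian_pdf 0 (1 ^+ 2)%:M x)%R.
Proof.
move=> r0; rewrite !gaussian_pdf_prod ?invr_gt0//.
rewrite (_ : expR _ = \prod_(i < n) expR (- ((r ^+ 2 - 1) * (x 0 i * x 0 i) /
  2)))%R.
  rewrite -[X in (r ^+ X)%R](card_ord n) -prodr_const -!big_split/=.
  apply: eq_bigr => i _.
  rewrite !normal_pdfE ?gt_eqF ?invr_gt0// /normal_peak /normal_fun !mxE.
  rewrite !subr0 [RHS]mulrACA -expRD; congr (_ * expR _)%R.
    rewrite expr1n mul1r -mulrnAr sqrtrM ?sqr_ge0// sqrtr_sqr gtr0_norm
      ?invr_gt0//.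
    by rewrite invfM invrK.
  by field; rewrite gt_eqF.
by rewrite -expR_sum /dot mulr_sumr mulr_suml -sumrN.
Qed.

(** One integral against the Gaussian law of variance [r ^- 2], written in two ways: by rescaling
    the variable, and by tilting the standard density. *)
Lemma ge0_integral_gauss_scale (r : R) (f : borel R n -> \bar R) : (0 < r)%R ->
  measurable_fun setT f -> (forall x, 0 <= f x) ->
  \int[gauss R n]_x f (r^-1 *: (x : 'rV_n))%R =
  (r ^+ n)%:E * \int[gauss R n]_x
     ((expR (- ((r ^+ 2 - 1) * dot x x / 2)))%:E * f x).
Proof.
move=> r0 mf f0.
have := @lebesgue_int_gaussian R n 0%R r^-1%R 1%R f.
rewrite invr_gt0 => /(_ r0 ler01 mf f0); rewrite mul1e => H.
under eq_integral => x _ do rewrite -[(r^-1 *: _)%R]add0r.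
rewrite -H.
pose g (x : borel R n) := (expR (- ((r ^+ 2 - 1) * dot x x / 2)))%:E * f x.
have mg : measurable_fun setT g.
  apply: emeasurable_funM => //; apply/measurable_EFinP/measurableT_comp => //.
  apply: measurableT_comp => //; apply: measurable_funM => //.
  by apply: measurable_funM => //; exact: measurable_dot_self.
have g0 x : 0 <= g x by rewrite mule_ge0// lee_fin expR_ge0.
have := @lebesgue_int_gaussian R n 0%R 1%R (r ^+ n)%R g ltr01 (exprn_ge0 _
  (ltW r0)) mg g0.
under eq_integral => x _ do rewrite scale1r add0r.
move=> <-; congr lebesgue_int; apply/funext => x.
by rewrite /g muleA -EFinM gaussian_pdf_scale// mul1r mulrAC.
Qed.

End gaussian_scaling.

(** * Moments of the Euclidean norm *)

Lemma measurable_invr (R : realType) : measurable_fun setT (fun x : R => x^-1).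
Proof.
rewrite -(setvU [set 0]); apply/measurable_funU => //; first exact: measurableC.
split; last exact: measurable_fun_set1.
apply: open_continuous_measurable_fun => //.
  rewrite (_ : ~` _ = [set x | x != 0]); first exact: open_neq.
  by apply/seteqP; split => x /= /eqP.
by move=> x /set_mem/= /eqP x0; exact: inv_continuous.
Qed.

Lemma ge0_integralDZ d (T : measurableType d) (R : realType)
    (m : {measure set T -> \bar R}) (f g : T -> \bar R) (c : R) : 0 <= c ->
  measurable_fun setT f -> (forall x, 0 <= f x)%E ->
  measurable_fun setT g -> (forall x, 0 <= g x)%E ->
  (\int[m]_x (f x + c%:E * g x) = \int[m]_x f x + c%:E * \int[m]_x g x)%E.
Proof.
move=> c0 mf f0 mg g0; have mcg :=
  emeasurable_funM (@measurable_cst _ _ T (\bar R) setT c%:E) mg.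
rewrite ge0_integralD//; last by move=> x _; rewrite mule_ge0.
by rewrite ge0_integralZl.
Qed.

(** The remainder in the induction step is [N * (r - 1) ^+ 2], whatever the sign of [r - 1]; both
    [r > 1] and [r < 1] occur below. *)
Lemma bernoulli_le (R : realDomainType) (r : R) (N : nat) :
  0 <= r -> 1 + N%:R * (r - 1) <= r ^+ N.
Proof.
move=> r0; elim: N => [|N IH]; first by rewrite mul0r addr0 expr0.
rewrite exprS -natr1; apply: le_trans (ler_wpM2l r0 IH).
rewrite -subr_ge0 (_ : _ - _ = N%:R * (r - 1) ^+ 2); last by ring.
by rewrite mulr_ge0 ?sqr_ge0.
Qed.

(* For G homogeneous of degree j and N = n + j, scaling turns the integral of
   [expR (- (r ^+ 2 - 1) |x|^2 / 2) * G x] into [r ^- N] times that of G; the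
   bounds follow from [1 + t <= expR t] and r -> 1. One-sided scaling hypotheses
   allow regularized negative powers, for which only an inequality holds. *)
Section gaussian_moments.
Context (R : realType) (n : nat).
Local Open Scope ereal_scope.

Let u (x : borel R n) : R := dot (x : 'rV_n) x.
Let mu : measurable_fun setT u. Proof. exact: measurable_dot_self. Qed.
Let u0 x : (0 <= u x)%R. Proof. exact: dot_self_ge0. Qed.

Section comparison.
Variables (N : nat) (G : borel R n -> R) (i : R).
Hypotheses (mG : measurable_fun setT G) (G0 : forall x, (0 <= G x)%R).
Hypothesis iE : \int[gauss R n]_x (G x)%:E = i%:E.

Let w (r : R) (x : borel R n) :=
  (expR (- ((r ^+ 2 - 1) * u x / 2)))%:E * (G x)%:E.

Let mw r : measurable_fun setT (w r).
Proof.
apply: emeasurable_funM; last exact/measurable_EFinP.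
apply/measurable_EFinP/measurableT_comp => //.
by apply: measurableT_comp => //; do 2 apply: measurable_funM => //.
Qed.

Let w0 r x : 0 <= w r x. Proof. by rewrite mule_ge0// lee_fin// expR_ge0. Qed.

(** By the change of scale, [r ^+ n] times the tilted integral is the integral of [G] at [x / r].
    The hypothesis compares [r ^+ N] times the latter with [r ^+ n * i]; cancelling [r ^+ n] gives
    the bound, and with it finiteness. *)
Let tilted (r : R) : (0 < r)%R ->
  (forall x, r ^+ N * G (r^-1 *: (x : 'rV_n)) <= r ^+ n * G x)%R ->
  exists2 e, \int[gauss R n]_x w r x = e%:E & (r ^+ N * e <= i)%R.
Proof.
move=> r0 hG.
have mGe : measurable_fun setT (fun x => (G x)%:E) by exact/measurable_EFinP.
have H := ge0_integral_gauss_scale r0 mGe (fun x => G0 x).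
have rn0 : (0 < r ^+ n)%R by rewrite exprn_gt0.
have rN0 : (0 < r ^+ N)%R by rewrite exprn_gt0.
have : (r ^+ N)%:E * ((r ^+ n)%:E * \int[gauss R n]_x w r x) <=
  (r ^+ n)%:E * i%:E.
  have mGr : measurable_fun setT (fun x : borel R n => (G (r^-1 *: (x :
    'rV_n))%R)%:E).
    have := measurableT_comp mGe (@measurable_affine_row R n 0%R r^-1%R).
    by congr measurable_fun; apply/funext => x /=; rewrite add0r.
  rewrite /w -H -iE -ge0_integralZl//; last 2 first.
    by move=> x _; rewrite lee_fin.
    by rewrite lee_fin ltW.
  rewrite -ge0_integralZl//; last 2 first.
    by move=> x _; rewrite lee_fin.
    by rewrite lee_fin ltW.
  apply: ge0_le_integral => //.
  - by move=> x _; rewrite mule_ge0 // lee_fin // ltW.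
  - exact: emeasurable_funM.
  - exact: emeasurable_funM.
  - by move=> x _; rewrite -!EFinM lee_fin; exact: hG.
have E0 : 0 <= \int[gauss R n]_x w r x by exact: integral_ge0.
move: E0; case: (\int[gauss R n]_x w r x) => [e||]//.
- by rewrite -!EFinM !lee_fin => e0; rewrite mulrCA ler_pM2l//; exists e.
- by move=> _; rewrite !gt0_muley ?lte_fin.
Qed.

Let J := \int[gauss R n]_x (u x * G x)%:E.

Let uG0 x : (0 <= u x * G x)%R. Proof. exact: mulr_ge0. Qed.
Let muG : measurable_fun setT (fun x => (u x * G x)%:E).
Proof. by apply/measurable_EFinP; exact: measurable_funM. Qed.
Let mGe : measurable_fun setT (fun x => (G x)%:E). Proof.
  exact/measurable_EFinP. Qed.
Let Ge0 x : 0 <= (G x)%:E. Proof. by rewrite lee_fin. Qed.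
Let uGe0 x : 0 <= (u x * G x)%:E. Proof. by rewrite lee_fin. Qed.
Let J0 : 0 <= J. Proof. by apply: integral_ge0 => x _; rewrite lee_fin. Qed.

Lemma gauss_moment_ge :
  (forall (r : R) (x : borel R n), (1 < r)%R ->
    (r ^+ N * G (r^-1 *: (x : 'rV_n)) <= r ^+ n * G x)%R) ->
  (N%:R * i)%:E <= J.
Proof.
move=> hG; have key (r : R) : (1 < r)%R -> (N%:R * i)%:E <=
  (r ^+ N * (r + 1) / 2)%:E * J.
  move=> r1; have r0 : (0 < r)%R := lt_trans ltr01 r1.
  have [e eE ei] := tilted r0 (fun x => hG r x r1).
  pose c := ((r ^+ 2 - 1) / 2)%R.
  have c0 : (0 < c)%R by rewrite divr_gt0// subr_gt0 exprn_egt1.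
  have : i%:E <= e%:E + c%:E * J.
    rewrite -eE -iE /J -(ge0_integralDZ _ (ltW c0) (mw r) (w0 r) muG uGe0).
    apply: ge0_le_integral_nonmeasurable => // x.
    rewrite /w -!EFinM -EFinD lee_fin mulrA -mulrDl.
    rewrite ler_peMl//; rewrite -lerBlDr; apply: le_trans (expR_ge1Dx _).
    by rewrite /c mulrAC.
  move: (J0); case: (J) => [j||]//.
    move=> _; rewrite -!EFinM -EFinD !lee_fin => h.
    have hb := bernoulli_le N (ltW r0).
    have i0 : (0 <= i)%R.
      by rewrite -lee_fin -iE; apply: integral_ge0 => x _; rewrite lee_fin.
    have rN0 : (0 < r ^+ N)%R by rewrite exprn_gt0.
    (* Both sides of the estimate vanish to first order at r = 1; Bernoulli replaces [r ^+ N - 1] by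
       [N * (r - 1)], and [r - 1] cancels. *)
    rewrite -(@ler_pM2l _ (r - 1)) ?subr_gt0//.
    have h1 : (r ^+ N * i <= r ^+ N * e + r ^+ N * (c * j))%R.
      by rewrite -mulrDr ler_pM2l.
    have h2 : (N%:R * (r - 1) * i <= (r ^+ N - 1) * i)%R.
      by apply: ler_wpM2r => //; lra.
    have -> : ((r - 1) * (r ^+ N * (r + 1) / 2 * j) = r ^+ N * (c * j))%R.
      by rewrite /c; field.
    by lra.
  by move=> _ _; rewrite gt0_muley ?leey// lte_fin divr_gt0// mulr_gt0
    ?exprn_gt0// addr_gt0.
move: (J0) key; case: (J) => [j||]//; last by move=> _ _; exact: leey.
rewrite !lee_fin => j0 key; rewrite leNgt; apply/negP => lt.
(* The factor in [key] tends to 1, so a strict violation in the limit would already occur at some r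
   > 1. *)
pose phi r := (r ^+ N * (r + 1) / 2 * j)%R.
have cphi : phi r @[r --> (1 : R)^'+] --> phi 1%R.
  apply: cvg_at_right_filter; apply: cvgMl; apply: cvgMl; apply: cvgM.
    exact: exprn_continuous.
  by apply: cvgD => //; exact: cvg_cst.
have : (phi 1 < N%:R * i)%R.
  by rewrite /phi expr1n mul1r -[(1 + 1)%R]/2%:R divff// mul1r.
move/(cvgr_lt _ cphi) => near1.
have [r [r1 hr]] : exists r, (1 < r)%R /\ (phi r < N%:R * i)%R.
  near (1 : R)^'+ => r; exists r; split; near: r => //.
  exact: nbhs_right_gt.
by have := key r r1; rewrite -EFinM lee_fin leNgt hr.
Unshelve. all: by end_near. Qed.

Lemma gauss_moment_le :
  (forall (r : R) (x : borel R n), (0 < r < 1)%R ->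
    (r ^+ N * G (r^-1 *: (x : 'rV_n)) <= r ^+ n * G x)%R) ->
  J <= (N%:R * i)%:E.
Proof.
move=> hG; have key (r : R) : (0 < r < 1)%R ->
  (r ^+ N * (r + 1) / 2)%:E * J <= (N%:R * i)%:E.
  move=> /[dup] r01 /andP[r0 r1].
  have [e eE ei] := tilted r0 (fun x => hG r x r01).
  pose c := ((1 - r ^+ 2) / 2)%R.
  have c0 : (0 < c)%R by rewrite divr_gt0// subr_gt0 exprn_ilt1// ltW.
  have : i%:E + c%:E * J <= e%:E.
    rewrite -eE -iE /J -(ge0_integralDZ _ (ltW c0) mGe Ge0 muG uGe0).
    apply: ge0_le_integral_nonmeasurable => x.
      by rewrite adde_ge0// mule_ge0// lee_fin ltW.
    rewrite /w -!EFinM -EFinD lee_fin mulrA -[X in (X + _ <= _)%R]mul1r -mulrDl.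
    rewrite ler_wpM2r//; apply: le_trans (expR_ge1Dx _).
    by rewrite /c lerD2l le_eqVlt; apply/orP; left; apply/eqP; field.
  move: (J0); case: (J) => [j||]//; last first.
    by move=> _; rewrite gt0_muley ?lte_fin// addey.
  move=> _; rewrite -!EFinM -EFinD !lee_fin => h.
  have hb := bernoulli_le N (ltW r0).
  have i0 : (0 <= i)%R.
    by rewrite -lee_fin -iE; apply: integral_ge0 => x _; rewrite lee_fin.
  have rN0 : (0 < r ^+ N)%R by rewrite exprn_gt0.
  rewrite -(@ler_pM2l _ (1 - r)) ?subr_gt0//.
  have h1 : (r ^+ N * i + r ^+ N * (c * j) <= r ^+ N * e)%R.
    by rewrite -mulrDr ler_pM2l.
  have h2 : ((1 - r ^+ N) * i <= N%:R * (1 - r) * i)%R.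
    by apply: ler_wpM2r => //; lra.
  have -> : ((1 - r) * (r ^+ N * (r + 1) / 2 * j) = r ^+ N * (c * j))%R.
    by rewrite /c; field.
  by lra.
(* The instance r = 1/2 excludes an infinite [J]; the sharp constant comes from r tending to 1. *)
have half : (0 < (2^-1 : R) < 1)%R by rewrite invr_gt0 ltr0n invf_lt1// ltr1n.
have := key _ half.
move: (J0) key; case: (J) => [j||]//; last first.
  by move=> _ _; rewrite gt0_muley.
rewrite !lee_fin => j0 key _; rewrite leNgt; apply/negP => lt.
pose phi r := (r ^+ N * (r + 1) / 2 * j)%R.
have cphi : phi r @[r --> (1 : R)^'-] --> phi 1%R.
  apply: cvg_at_left_filter; apply: cvgMl; apply: cvgMl; apply: cvgM.
    exact: exprn_continuous.
  by apply: cvgD => //; exact: cvg_cst.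
have : (N%:R * i < phi 1)%R.
  by rewrite /phi expr1n mul1r -[(1 + 1)%R]/2%:R divff// mul1r.
move/(cvgr_gt _ cphi) => near1.
have [r [r01 hr]] : exists r, (0 < r < 1)%R /\ (N%:R * i < phi r)%R.
  near (1 : R)^'- => r; exists r; split; last by near: r.
  by apply/andP; split; near: r; [exact: nbhs_left_gt|exact: nbhs_left_lt].
by have := key r r01; rewrite -EFinM lee_fin leNgt hr.
Unshelve. all: by end_near. Qed.

End comparison.
End gaussian_moments.

(** * Positive and negative moments of the Gaussian Euclidean norm *)

Section norm_moments.
Context (R : realType) (n : nat).
Local Open Scope ereal_scope.

Let u (x : borel R n) : R := dot (x : 'rV_n) x.
Let mu : measurable_fun setT u. Proof. exact: measurable_dot_self. Qed.
Let u0 x : (0 <= u x)%R. Proof. exact: dot_self_ge0. Qed.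

Let uZ (r : R) x : u (r *: (x : 'rV_n))%R = (r ^+ 2 * u x)%R.
Proof.
by rewrite /u /dot mulr_sumr; apply: eq_bigr => i _; rewrite !mxE mulrACA expr2.
Qed.

Lemma integral_gauss_cst (c : R) : \int[gauss R n]_x c%:E = c%:E.
Proof. by rewrite integral_cst// [X in _ * X](@probability_setT _ _ _ (gauss R
  n)) mule1. Qed.

Lemma gauss_normsq : \int[gauss R n]_x (dot (x : 'rV_n) x)%:E = n%:R%:E.
Proof.
have J1 : \int[gauss R n]_x (u x)%:E = \int[gauss R n]_x (u x * (cst 1%R x))%:E.
  by apply: eq_integral => x _; rewrite mulr1.
rewrite -[LHS]/(\int[gauss R n]_x (u x)%:E) J1.
apply/eqP; rewrite eq_le -[n%:R]mulr1; apply/andP; split.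
- by apply: (gauss_moment_le _ _ (integral_gauss_cst 1)) => //= r x /andP[/ltW].
- by apply: (gauss_moment_ge _ _ (integral_gauss_cst 1)) => //= r x
  /ltW/(le_trans ler01).
Qed.

(** Here G = |x|^2 is homogeneous of degree 2, which explains the factor n + 2. *)
Lemma gauss_norm4_le :
  \int[gauss R n]_x (dot (x : 'rV_n) x ^+ 2)%:E <= ((n.+2)%:R * n%:R)%:E.
Proof.
under eq_integral => x _ do rewrite expr2.
apply: (gauss_moment_le _ _ gauss_normsq) => //= r x /andP[r0 _].
rewrite -/(u _) uZ exprVn !exprS !mulrA mulrAC.
by rewrite le_eqVlt; apply/orP; left; apply/eqP; rewrite -/(u x); field;
  rewrite gt_eqF.
Qed.

(** The value is n (n + 2) - n^2. The cross term [2 * n * |x|^2] is moved to the other side, so that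
    every integrand is nonnegative. *)
Lemma gauss_normsq_variance :
  \int[gauss R n]_x ((dot (x : 'rV_n) x - n%:R) ^+ 2)%:E <= (2 * n%:R)%:E.
Proof.
have mV : measurable_fun setT (fun x => ((u x - n%:R) ^+ 2)%:E).
  by apply/measurable_EFinP/measurable_funX/measurable_funB.
have mU : measurable_fun setT (fun x => (u x)%:E) by exact/measurable_EFinP.
have mU2 : measurable_fun setT (fun x => (u x ^+ 2)%:E).
  by apply/measurable_EFinP/measurable_funX.
have n0 : (0 <= 2 * n%:R :> R)%R by rewrite mulr_ge0.
have V0 x : 0 <= ((u x - n%:R) ^+ 2)%:E by rewrite lee_fin sqr_ge0.
have U0 x : 0 <= (u x)%:E by rewrite lee_fin.
have U20 x : 0 <= (u x ^+ 2)%:E by rewrite lee_fin sqr_ge0.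
have C0 (x : borel R n) : 0 <= (n%:R ^+ 2 : R)%:E by rewrite lee_fin sqr_ge0.
have := ge0_integralDZ (gauss R n) n0 mV V0 mU U0.
rewrite gauss_normsq.
have -> : \int[gauss R n]_x (((u x - n%:R) ^+ 2)%:E + (2 * n%:R)%:E * (u
  x)%:E) =
   \int[gauss R n]_x ((u x ^+ 2)%:E + 1%:E * (n%:R ^+ 2)%:E).
  by apply: eq_integral => x _; rewrite -!EFinM -!EFinD; congr _%:E; ring.
rewrite (ge0_integralDZ (gauss R n) ler01 mU2 U20 (measurable_cst _) C0).
rewrite integral_gauss_cst mul1e => h.
have := gauss_norm4_le; rewrite -[X in X <=
  _]/(\int[gauss R n]_x (u x ^+ 2)%:E) => h4.
rewrite -(@leeD2rE _ ((2 * n%:R)%:E * n%:R%:E)%E) -?EFinM// -[X in X + _ <=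
  _]/(\int[gauss R n]_x ((u x - n%:R) ^+ 2)%:E) EFinM -h.
apply: le_trans (leeD2r _ h4) _.
by rewrite -!EFinM -!EFinD lee_fin -natr1 -natr1; clear C0; lra.
Qed.

Section inverse_moments.
Variables (k : nat) (h : borel R n -> R) (q : R).
Hypotheses (mh : measurable_fun setT h) (h0 : forall x, (0 <= h x)%R).
Hypothesis hZ : forall (r : R) (x : borel R n), (0 < r)%R ->
  h (r *: (x : 'rV_n))%R = (r ^+ k * h x)%R.
Hypothesis hq : \int[gauss R n]_x (h x)%:E = q%:E.

Let ue0 (eps : R) x : (0 < eps)%R -> (0 < u x + eps)%R.
Proof. by move=> e0; rewrite ltr_wpDl. Qed.

Let mhu (eps : R) i : measurable_fun setT (fun x => (h x / (u x + eps) ^+ i)%R).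
Proof.
apply: measurable_funM => //.
apply: (measurableT_comp (@measurable_invr R)).
by apply: measurable_funX; exact: measurable_funD.
Qed.

Let hu0 (eps : R) i x : (0 < eps)%R -> (0 <= h x / (u x + eps) ^+ i)%R.
Proof. by move=> e0; rewrite divr_ge0// exprn_ge0// ltW// ue0. Qed.

(** The lower moment bound for G = h / (|x|^2 + eps)^(i+1), which would have degree k - 2 (i + 1) at
    eps = 0; then |x|^2 G is at most the integrand with exponent i. The regularization keeps the
    integral of G finite. *)
Lemma gauss_inverse_step (eps : R) (i N : nat) : (0 < eps)%R ->
  (N + i.+1.*2 = n + k)%N ->
  N%:R%:E * \int[gauss R n]_x (h x / (u x + eps) ^+ i.+1)%:E <=
  \int[gauss R n]_x (h x / (u x + eps) ^+ i)%:E.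
Proof.
move=> e0 NE.
have I0 : 0 <= \int[gauss R n]_x (h x / (u x + eps) ^+ i.+1)%:E.
  by apply: integral_ge0 => x _; rewrite lee_fin hu0.
have Ile : \int[gauss R n]_x (h x / (u x + eps) ^+ i.+1)%:E <=
  (eps ^- i.+1 * q)%:E.
  rewrite EFinM -hq -ge0_integralZl//; last 3 first.
  - exact/measurable_EFinP.
  - by move=> x _; rewrite lee_fin.
  - by rewrite lee_fin invr_ge0 exprn_ge0// ltW.
  apply: ge0_le_integral_nonmeasurable => x; first by rewrite lee_fin hu0.
  rewrite -EFinM lee_fin mulrC ler_wpM2r// lef_pV2 ?posrE ?exprn_gt0 ?ue0//.
  by apply: lerXn2r; rewrite ?nnegrE ?lerDr ?(ltW e0) ?(ltW (ue0 x e0)).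
have [j jE] : exists j, \int[gauss R n]_x (h x / (u x + eps) ^+ i.+1)%:E = j%:E.
  move: I0 Ile; case: (\int[gauss R n]_x _) => [j||]// _ _.
  by exists j.
rewrite jE -EFinM.
apply: le_trans (gauss_moment_ge (N :=
  N) (mhu eps i.+1) (fun x => hu0 i.+1 x e0) jE _) _.
- move=> r x r1; have r0 : (0 < r)%R := lt_trans ltr01 r1.
  rewrite hZ ?invr_gt0// -/(u _) uZ !exprVn.
  set a := (r ^- 2 * u x + eps)%R; set b := (u x + eps)%R.
  have b0 : (0 < b)%R by exact: ue0.
  (* Since r > 1, scaling enlarges [eps]; this is the direction in which homogeneity fails, and it
     is the admissible one. *)
  have ab : (b <= r ^+ 2 * a)%R.
    rewrite /a /b mulrDr mulrA divff ?mul1r ?expf_neq0 ?gt_eqF// lerD2l.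
    by rewrite ler_peMl ?(ltW e0)// exprn_ege1// ltW.
  have a0 : (0 < a)%R by rewrite -(@pmulr_rgt0 _ (r ^+ 2)) ?exprn_gt0//;
    exact: lt_le_trans ab.
  have rk0 : (r ^+ k != 0)%R by rewrite expf_neq0// gt_eqF.
  have abi : (b ^+ i.+1 <= r ^+ i.+1.*2 * a ^+ i.+1)%R.
    rewrite -mul2n exprM -exprMn; apply: lerXn2r; rewrite ?nnegrE ?(ltW b0)//.
    by apply: mulr_ge0; [exact: sqr_ge0|exact: ltW].
  have ai0 : (0 < a ^+ i.+1)%R by rewrite exprn_gt0.
  have bi0 : (0 < b ^+ i.+1)%R by rewrite exprn_gt0.
  have rNk : (r ^+ N * r ^+ i.+1.*2 = r ^+ n * r ^+ k)%R by rewrite -!exprD NE.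
  rewrite -(@ler_pM2r _ (r ^+ k * a ^+ i.+1 * b ^+ i.+1)) ?mulr_gt0
    ?exprn_gt0//.
  have lhsE (p t y z : R) : (t != 0 -> y != 0 ->
    p * (t^-1 * h x / y) * (t * y * z) = h x * p * z)%R.
    by move=> *; field; apply/andP.
  have rhsE (p t y z : R) : (z != 0 -> p * (h x / z) * (t * y * z) =
    h x * (p * t) * y)%R.
    by move=> *; field.
  rewrite [leLHS]lhsE ?gt_eqF ?exprn_gt0// [leRHS]rhsE ?gt_eqF// -rNk.
  rewrite (_ : h x * (_ * _) * _ =
    h x * r ^+ N * (r ^+ i.+1.*2 * a ^+ i.+1))%R; last by rewrite !mulrA.
  by rewrite ler_wpM2l// mulr_ge0// exprn_ge0// ltW.
- apply: ge0_le_integral_nonmeasurable => x; rewrite lee_fin.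
    by rewrite mulr_ge0// ?hu0//; exact: u0.
  have b0 := ue0 x e0.
  have -> : (u x * (h x / (u x + eps) ^+ i.+1) =
    u x / (u x + eps) * (h x / (u x + eps) ^+ i))%R.
    by rewrite exprS invfM -!mulrA (mulrCA (h x)).
  by rewrite ler_piMl ?hu0// ler_pdivrMr// mul1r lerDl ltW.
Qed.

Hypothesis kn : (k < n)%N.

(** The step from i to i + 1 divides by n + k - 2 (i + 1), which is at least n - k while i < k. *)
Let gauss_inverse_eps (eps : R) (i : nat) : (0 < eps)%R -> (i <= k)%N ->
  \int[gauss R n]_x (h x / (u x + eps) ^+ i)%:E <= (q / (n%:R - k%:R) ^+ i)%:E.
Proof.
move=> e0; have nk0 : (0 < n%:R - k%:R :> R)%R by rewrite subr_gt0 ltr_nat.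
elim: i => [_|i IH ik].
  by rewrite expr0 divr1 -hq; under eq_integral do rewrite expr0 divr1.
have := @gauss_inverse_step eps i (n + k - i.+1.*2) e0.
rewrite subnK; last by rewrite -addnn leq_add// (leq_trans ik)// ltnW.
move=> /(_ erefl) step; have := le_trans step (IH (ltnW ik)).
have I0 : 0 <= \int[gauss R n]_x (h x / (u x + eps) ^+ i.+1)%:E.
  by apply: integral_ge0 => x _; rewrite lee_fin hu0.
have N1 : (n%:R - k%:R <= (n + k - i.+1.*2)%:R :> R)%R.
  rewrite natrB; last by rewrite -addnn leq_add// (leq_trans ik)// ltnW.
  rewrite natrD -addnn natrD.
  have : (i.+1%:R <= k%:R :> R)%R by rewrite ler_nat.
  lra.
move=> hle; have : (n%:R - k%:R)%:E * \int[gauss R n]_x (h x / (u x + eps) ^+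
  i.+1)%:E <=
   (q / (n%:R - k%:R) ^+ i)%:E.
  by apply: le_trans hle; apply: lee_wpmul2r.
by rewrite -lee_pdivlMl// -EFinM exprS invfM mulrCA.
Qed.

(** Monotone convergence along eps = 1 / (m + 1). At the origin, where division by |x|^2 is a
    convention, [h] vanishes and all the quotients are 0. *)
Lemma gauss_inverse_moment : h 0%R = 0%R ->
  \int[gauss R n]_x (h x / dot (x : 'rV_n) x ^+ k)%:E <=
  (q / (n%:R - k%:R) ^+ k)%:E.
Proof.
move=> h00; pose g m x := (h x / (u x + m.+1%:R^-1) ^+ k)%:E.
have em m : (0 < m.+1%:R^-1 :> R)%R by [].
have lim_g x : (fun m => g m x) @ \oo --> (h x / u x ^+ k)%:E.
  have [x0|x0] := eqVneq (x : 'rV_n) 0%R.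
    have hx : h x = 0%R by rewrite x0.
    by rewrite /g hx mul0r; under eq_fun do rewrite mul0r; exact: cvg_cst.
  have ux : (u x != 0)%R.
    apply: contra_neq x0 => /eqP; rewrite /u /dot psumr_eq0; last first.
      by move=> i _; rewrite -expr2 sqr_ge0.
    move=> /allP xi; apply/rowP => i; rewrite mxE; apply/eqP.
    by have := xi i (mem_index_enum _); rewrite -expr2 sqrf_eq0.
  have cue : (fun m => u x + m.+1%:R^-1)%R @ \oo --> u x.
    rewrite -[X in _ --> X]addr0.
    exact: (@cvgD _ R^o _ \oo _ (cst (u x)) (@harmonic R) _ _ (cvg_cst _)
      (@cvg_harmonic R)).
  have cuk : (fun m => (u x + m.+1%:R^-1) ^+ k)%R @ \oo --> (u x ^+ k)%R.
    by apply: (cvg_comp _ (fun r => r ^+ k)%R cue); exact: exprn_continuous.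
  have H : (fun m => h x / (u x + m.+1%:R^-1) ^+ k)%R @ \oo --> (h x / u x ^+
    k)%R.
    by apply: cvgM; [exact: cvg_cst|apply: cvgV => //; rewrite expf_neq0].
  by apply/fine_cvgP; split; [near=> m|exact: H].
rewrite (_ : \int[_]_x _ = \int[gauss R n]_x limn (fun m => g m x)); last first.
  by apply: eq_integral => x _; apply/esym/cvg_lim => //; exact: lim_g.
have mg m : measurable_fun setT (g m) by apply/measurable_EFinP; exact: mhu.
have g0 m x : 0 <= g m x by rewrite lee_fin hu0.
have ndg x : nondecreasing_seq (fun m => g m x).
  move=> a b ab; rewrite lee_fin ler_wpM2l//.
  rewrite lef_pV2 ?posrE ?exprn_gt0 ?ue0//.
  apply: lerXn2r; rewrite ?nnegrE ?(ltW (ue0 x (em _)))// lerD2l.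
  by rewrite lef_pV2 ?posrE// ler_nat ltnS.
rewrite monotone_convergence//.
apply: lime_le.
  apply: ereal_nondecreasing_is_cvgn => a b ab.
  by apply: ge0_le_integral_nonmeasurable => x //; exact: ndg.
by apply: nearW => m; exact: gauss_inverse_eps.
Unshelve. all: by end_near. Qed.

End inverse_moments.

(** The indicator of the origin is at most eps / (|x|^2 + eps), whose mean is at most eps / (n - 2)
    by the inverse step with h = 1. *)
Lemma gauss_zero : (2 < n)%N ->
  \int[gauss R n]_x (\1_[set 0%R : 'rV_n] x)%:E = 0.
Proof.
move=> n2; apply/eqP; rewrite eq_le; apply/andP; split; last first.
  by apply: integral_ge0 => x _; rewrite lee_fin.
apply/lee_addgt0Pr => eps e0; rewrite add0e.
have h1 : forall (r : R) (x : borel R n), (0 < r)%R ->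
  (cst 1 (r *: (x : 'rV_n)) = r ^+ 0 * cst 1 x :> R)%R.
  by move=> r x _; rewrite mulr1.
have := @gauss_inverse_step 0 (cst 1%R) 1%R (measurable_cst _) (fun=> ler01)
  h1 (integral_gauss_cst 1) eps 0 (n - 2) e0.
rewrite addn0 subnK ?(ltnW n2)// => /(_ erefl).
rewrite (_ : \int[_]_x (cst 1 x / (u x + eps) ^+ 0)%:E = 1); last first.
  by under eq_integral do rewrite expr0 divr1; rewrite integral_gauss_cst.
move=> h.
have I0 : 0 <= \int[gauss R n]_x (cst 1 x / (u x + eps) ^+ 1)%:E.
  by apply: integral_ge0 => x _; rewrite lee_fin divr_ge0// addr_ge0// ltW.
have le1 : \int[gauss R n]_x (cst 1 x / (u x + eps) ^+ 1)%:E <= 1.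
  apply: le_trans h; rewrite -[X in X <= _]mul1e; apply: lee_wpmul2r => //.
  by rewrite lee_fin ler1n subn_gt0.
have : eps%:E * \int[gauss R n]_x (cst 1 x / (u x + eps) ^+ 1)%:E <= eps%:E.
  by rewrite -[X in _ <= X]mule1; apply: lee_wpmul2l => //; rewrite lee_fin ltW.
apply: le_trans; rewrite -ge0_integralZl//; last 3 first.
- apply/measurable_EFinP/measurable_funM => //.
  apply: (measurableT_comp (@measurable_invr R)).
  by apply: measurable_funX; exact: measurable_funD.
- by move=> x _; rewrite lee_fin divr_ge0// addr_ge0// ltW.
- by rewrite lee_fin ltW.
apply: ge0_le_integral_nonmeasurable => x; first by rewrite lee_fin.
rewrite -EFinM lee_fin indicE; case: (boolP (x \in _)) => [/set_mem ->|_].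
  rewrite (_ : u 0 = 0)%R ?add0r ?expr1 ?mul1r ?divff ?gt_eqF//.
  by rewrite /u /dot big1// => i _; rewrite mxE mul0r.
by apply: mulr_ge0; [exact: ltW|rewrite expr1 divr_ge0// addr_ge0// ltW].
Qed.

End norm_moments.

(** * Gaussian concentration *)

Section midpoint_measure.
Context (R : realType).
Local Notation lam := (@lebesgue_measure R).

Lemma lebesgue_measure_le_diam (A : set (measurableTypeR R)) : measurable A ->
  has_sup A -> has_inf A -> (lam A <= (sup A - inf A)%:E)%E.
Proof.
move=> mA supA infA; have sub : A `<=` `[inf A, sup A]%classic.
  move=> x Ax /=; rewrite in_itv/=; apply/andP; split.
    by apply: ge_inf => //; case: infA.
  by apply: ub_le_sup => //; case: supA.
have := le_measure lam; rewrite /=.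
move=> /(_ _ `[inf A, sup A]%classic (mem_set mA) (mem_set (measurable_itv _))
  sub).
move=> /le_trans; apply; rewrite lebesgue_measure_itv/= lte_fin.
case: ifPn => // _; rewrite lee_fin subr_ge0.
by have [[x Ax] _] := supA; have /= := sub x Ax;
  rewrite in_itv/= => /andP[/le_trans]; apply.
Qed.

(* One-dimensional Brunn-Minkowski in the only case needed: the target is
   symmetric and convex. *)
Lemma lebesgue_measure_midpoint (A B C : set (measurableTypeR R)) :
  measurable A -> measurable B -> measurable C -> A !=set0 -> B !=set0 ->
  (forall x y w : R, A x -> B y -> `|w| <= `|x + y| / 2 -> C w) ->
  (lam A + lam B <= 2%:E * lam C)%E.
Proof.
move=> mA mB mC A0 B0 ABC.
have [lamC|] := boolP (lam C == +oo%E).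
  by rewrite (eqP lamC) gt0_muley ?leey// lte_fin.
rewrite -ltey -ge0_fin_numE// => /fineK LE; set L := fine (lam C) in LE.
(* [C] contains an interval of length |x + y|, hence this bound. It gives sup A + sup B <= L and inf
   A + inf B >= - L, and neither set has measure above its diameter. *)
have xyL x y : A x -> B y -> `|x + y| <= L.
  move=> Ax By; pose z := `|x + y| / 2.
  have sub : `[- z, z]%classic `<=` C.
    by move=> w /=; rewrite in_itv/= -ler_norml; exact: ABC.
  have := le_measure lam; rewrite /=.
  move=> /(_ `[- z, z]%classic _ (mem_set (measurable_itv _)) (mem_set mC) sub).
  have z0 : 0 <= z by rewrite divr_ge0.
  rewrite lebesgue_measure_itv/= lte_fin; case: ifPn => [_|].
    rewrite -LE -EFinD lee_fin opprK => h; rewrite (_ : `|x + y| = z + z)//.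
    by rewrite /z; field.
  rewrite -leNgt => zz; have : z = 0 by apply/eqP; rewrite eq_le z0 andbT; lra.
  move=> /eqP; rewrite mulf_eq0 invr_eq0 pnatr_eq0 orbF => /eqP ->.
  by rewrite -lee_fin LE.
have [x0 Ax0] := A0; have [y0 By0] := B0.
have xy_ub x y : A x -> B y -> x + y <= L.
  by move=> Ax By; apply: le_trans (xyL x y Ax By); exact: ler_norm.
have xy_lb x y : A x -> B y -> - L <= x + y.
  by move=> Ax By; have := xyL x y Ax By; rewrite ler_norml => /andP[].
have supA : has_sup A.
  by split => //; exists (L - y0) => x Ax; rewrite lerBrDr xy_ub.
have supB : has_sup B.
  by split => //; exists (L - x0) => y By; rewrite lerBrDl xy_ub.
have infA : has_inf A.
  by split => //; exists (- L - y0) => x Ax; rewrite lerBlDr xy_lb.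
have infB : has_inf B.
  by split => //; exists (- L - x0) => y By; rewrite lerBlDl xy_lb.
have s : sup A + sup B <= L.
  rewrite -lerBrDl; apply: ge_sup => // y By; rewrite lerBrDl -lerBrDr.
  by apply: ge_sup => // x Ax; rewrite lerBrDr xy_ub.
have i : - L <= inf A + inf B.
  rewrite -lerBlDl; apply: lb_le_inf => // y By; rewrite lerBlDl -lerBlDr.
  by apply: lb_le_inf => // x Ax; rewrite lerBlDr xy_lb.
rewrite -LE; apply: le_trans (leeD (lebesgue_measure_le_diam mA supA infA)
  (lebesgue_measure_le_diam mB supB infB)) _.
by rewrite -EFinM -EFinD lee_fin; lra.
Qed.

(** Heights are cut to ]0, 1[ because the functions compared are normalized to supremum 1: below
    that height their superlevel sets are nonempty, as the midpoint inequality requires. *)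
Definition subgraph (p : R ->
  R) : set (measurableTypeR R * measurableTypeR R) :=
  [set z | 0 < z.2 < 1 /\ z.2 < p z.1].

Lemma measurable_subgraph (p : R -> R) : measurable_fun setT p ->
  measurable (subgraph p).
Proof.
move=> mp.
have -> : subgraph p = snd @^-1` `]0, 1[%classic `&`
    (fun z => p z.1 - z.2) @^-1` `]0, +oo[%classic.
  by apply/seteqP; split => z /=; rewrite !in_itv/= andbT subr_gt0.
apply: measurableI.
  by rewrite -[X in measurable X]setTI; apply: measurable_snd.
rewrite -[X in measurable X]setTI.
have : measurable_fun setT (fun z : measurableTypeR R * measurableTypeR R => p
  z.1 - z.2).
  by apply: measurable_funB; [exact: measurableT_comp|exact: measurable_snd].
by apply.
Qed.

Lemma layer_cake (p : R -> R) : measurable_fun setT p -> (forall x, 0 <= p x) ->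
  (\int[lam]_x (Num.min (p x) 1)%:E =
   \int[lam]_t \int[lam]_x (\1_(subgraph p) (x, t))%:E)%E.
Proof.
move=> mp p0; have mS := measurable_subgraph mp.
rewrite -(@fubini_tonelli _ _ _ _ _ lam lam (fun z => (\1_(subgraph p)
  z)%:E)); last 2 first.
- exact/measurable_EFinP/measurable_indic.
- by move=> z; rewrite lee_fin.
apply: eq_integral => x _.
rewrite (_ : (fun t => _) = (fun t => (\1_(`]0%R,
  Num.min (p x) 1[%classic) t)%:E)); last first.
  apply/funext => t; rewrite !indicE; congr (_%:R%:E); apply: congr1.
  apply/idP/idP => /set_mem H; apply: mem_set; move: H;
    rewrite /= in_itv/= lt_min.
    by case=> /= /andP[-> ->] ->.
  by case/andP => t0 /andP[tp t1]; split => //=; rewrite t0 t1.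
rewrite integral_indic//= setIT lebesgue_measure_itv/= lte_fin.
case: ifPn => [_|]; first by rewrite oppr0 adde0.
rewrite lt_min ltr01 andbT -leNgt => px0; congr _%:E.
have -> : p x = 0 by apply/eqP; rewrite eq_le px0 p0.
by rewrite min_l.
Qed.

End midpoint_measure.

(** * A Prekopa-Leindler inequality on the line with Gaussian target *)

Section prekopa_leindler.
Context (R : realType).
Local Notation lam := (@lebesgue_measure R).
Local Notation phi := (normal_pdf (0 : R) 1).

Let phiE x : phi x = normal_peak 1 * expR (- x ^+ 2 / 2).
Proof. by rewrite normal_pdfE ?oner_eq0// /normal_fun subr0 expr1n. Qed.

Let phi_gt0 x : 0 < phi x.
Proof. by rewrite phiE mulr_gt0 ?expR_gt0 ?normal_peak_gt0 ?oner_eq0. Qed.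

Let le_phi x y : `|x| <= `|y| -> phi y <= phi x.
Proof.
move=> xy; rewrite !phiE ler_pM2l ?normal_peak_gt0 ?oner_eq0// ler_expR.
have : x ^+ 2 <= y ^+ 2 by rewrite -real_normK ?num_real// -[leRHS]real_normK
  ?num_real// lerXn2r.
lra.
Qed.

(** With f = F phi and g = G phi, the identity (x - y)^2 / 4 - x^2 / 2 - y^2 / 2 = - (x + y)^2 / 4
    turns the hypothesis into f(x) g(y) <= phi((x + y) / 2)^2. Dividing f and g by their suprema
    puts their superlevel sets on a common scale; the midpoint inequality is applied at each height
    and integrated over heights. *)
Lemma gauss_transport_real (F G : R -> R) :
  measurable_fun setT F -> measurable_fun setT G ->
  (forall x, 0 <= F x) -> (forall x, 0 <= G x) ->
  (forall x y, F x * G y <= expR ((x - y) ^+ 2 / 4)) ->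
  (exists x, 0 < F x) -> (exists y, 0 < G y) ->
  (\int[normal_prob 0%R 1%R]_x (F x)%:E * \int[normal_prob 0%R 1%R]_x (G x)%:E
    <= 1)%E.
Proof.
move=> mF mG F0 G0 FG [x0 Fx0] [y0 Gy0].
pose f x := F x * phi x; pose g x := G x * phi x.
have mf : measurable_fun setT f by apply: measurable_funM => //;
  exact: measurable_normal_pdf.
have mg : measurable_fun setT g by apply: measurable_funM => //;
  exact: measurable_normal_pdf.
have f0 x : 0 <= f x by rewrite mulr_ge0// ltW.
have g0 x : 0 <= g x by rewrite mulr_ge0// ltW.
have fg x y : f x * g y <= phi ((x + y) / 2) ^+ 2.
  rewrite /f /g !phiE; set pk := normal_peak 1; set ex := expR _;
    set ey := expR _; set em := expR _.
  rewrite [leLHS](_ : _ = pk ^+ 2 * (F x * G y * (ex * ey))); last by ring.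
  rewrite exprMn ler_pM2l ?exprn_gt0 ?normal_peak_gt0 ?oner_eq0//.
  rewrite expr2 -!expRD.
  apply: le_trans (ler_wpM2r (expR_ge0 _) (FG x y)) _.
  by rewrite -expRD ler_expR le_eqVlt; apply/orP; left; apply/eqP; field.
have fx0 : 0 < f x0 by rewrite mulr_gt0.
have gy0 : 0 < g y0 by rewrite mulr_gt0.
have phi_ub z : phi z <= phi 0 by apply: le_phi; rewrite normr0.
have fgb x y : f x * g y <= phi 0 ^+ 2.
  by apply: le_trans (fg x y) _; rewrite lerXn2r ?nnegrE// ltW.
(* [f] is bounded because the bound on the product can be divided by the positive value [g y0];
   symmetrically for [g]. *)
have hsf : has_sup (range f).
  split; first by exists (f x0), x0.
  exists (phi 0 ^+ 2 / g y0) => _ [x _ <-]; by rewrite ler_pdivlMr.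
have hsg : has_sup (range g).
  split; first by exists (g y0), y0.
  exists (phi 0 ^+ 2 / f x0) => _ [y _ <-]; by rewrite ler_pdivlMr// mulrC.
pose al := sup (range f); pose be := sup (range g).
have f_al x : f x <= al by apply: ub_le_sup; [case: hsf|exists x].
have g_be x : g x <= be by apply: ub_le_sup; [case: hsg|exists x].
have al0 : 0 < al := lt_le_trans fx0 (f_al x0).
have be0 : 0 < be := lt_le_trans gy0 (g_be y0).
pose ga := Num.sqrt (al * be).
have ga0 : 0 < ga by rewrite sqrtr_gt0 mulr_gt0.
have gaE : ga ^+ 2 = al * be by rewrite sqr_sqrtr// ltW// mulr_gt0.
pose pf x := f x / al; pose pg x := g x / be; pose ph x := phi x / ga.
have mpf : measurable_fun setT pf by exact: measurable_funM.
have mpg : measurable_fun setT pg by exact: measurable_funM.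
have mph : measurable_fun setT ph by apply: measurable_funM => //;
  exact: measurable_normal_pdf.
have pf0 x : 0 <= pf x by rewrite divr_ge0// ltW.
have pg0 x : 0 <= pg x by rewrite divr_ge0// ltW.
have ph0 x : 0 <= ph x by rewrite divr_ge0// ltW.
have pf1 x : pf x <= 1 by rewrite ler_pdivrMr// mul1r.
have pg1 x : pg x <= 1 by rewrite ler_pdivrMr// mul1r.
have msub (p : R -> R) t : measurable_fun setT p ->
  measurable [set x : measurableTypeR R | t < p x].
  move=> mp; rewrite (_ : [set x | _] = p @^-1` `]t, +oo[%classic); last first.
    by apply/seteqP; split => z /=; rewrite in_itv/= andbT.
  by rewrite -[X in measurable X]setTI; exact: mp.
have slice (p : R -> R) t : measurable_fun setT p -> 0 < t < 1 ->
    (\int[lam]_x (\1_(subgraph p) (x, t))%:E = lam [set x | (t < p x)%R])%E.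
  move=> mp t01; rewrite -[X in lam X]setIT -integral_indic//; last exact: msub.
  apply: eq_integral => x _; rewrite !indicE; congr (_%:R%:E); apply: congr1.
  by apply/idP/idP => /set_mem H; apply: mem_set; [by case: H|by split].
have mslice (p : R -> R) : measurable_fun setT p -> measurable_fun setT
    (fun t : measurableTypeR R => (\int[lam]_x (\1_(subgraph p) (x, t))%:E)%E).
  move=> mp; apply: (measurable_fun_fubini_tonelli_G (m1 :=
    lam) (fun z => (\1_(subgraph p) z)%:E)).
    apply/measurable_EFinP; apply: measurable_indic.
    exact: measurable_subgraph.
  by move=> z; rewrite lee_fin.
have slice0 (p : R -> R) t : (0 <= \int[lam]_x (\1_(subgraph p) (x, t))%:E)%E.
  by apply: integral_ge0 => x _; rewrite lee_fin.
have key : (\int[lam]_x (pf x)%:E + \int[lam]_x (pg x)%:E <=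
  2%:E * \int[lam]_x (ph x)%:E)%E.
  have minf : (\int[lam]_x (pf x)%:E = \int[lam]_x (Num.min (pf x) 1)%:E)%E.
    by apply: eq_integral => x _; rewrite min_l.
  have ming : (\int[lam]_x (pg x)%:E = \int[lam]_x (Num.min (pg x) 1)%:E)%E.
    by apply: eq_integral => x _; rewrite min_l.
  apply: (@le_trans _ _ (2%:E * \int[lam]_x (Num.min (ph x) 1)%:E)%E);
    last first.
    apply: lee_wpmul2l; first by rewrite lee_fin.
    by apply: ge0_le_integral_nonmeasurable => x;
      rewrite lee_fin ?le_min ?ph0 ?ler01// ge_min lexx.
  rewrite minf ming !layer_cake// -ge0_integralD//; last 2 first.
  - exact: mslice.
  - exact: mslice.
  rewrite -ge0_integralZl//; last by exact: mslice.
  apply: ge0_le_integral_nonmeasurable => t; first by rewrite adde_ge0.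
  have [t01|t01] := boolP (0 < t < 1); last first.
    have z p : (\int[lam]_x (\1_(subgraph p) (x, t))%:E = 0)%E.
      apply: integral0_eq => x _; rewrite indicE memNset//= => -[].
      by rewrite (negbTE t01).
    by rewrite !z mule0 adde0.
  have /andP[t0 t1] := t01.
  rewrite !slice//; apply: lebesgue_measure_midpoint; try exact: msub.
  - have : t * al < al by rewrite gtr_pMl.
    move=> /(sup_gt hsf.1)[_ [x _ <-]] tx; exists x => /=.
    by rewrite ltr_pdivlMr.
  - have : t * be < be by rewrite gtr_pMl.
    move=> /(sup_gt hsg.1)[_ [x _ <-]] tx; exists x => /=.
    by rewrite ltr_pdivlMr.
  (* Multiplying [t * al < f x] by [t * be < g y] gives [t * ga < phi ((x + y) / 2)] after a square
     root, and phi decreases in the absolute value. *)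
  move=> x y w /= tf tg wxy; rewrite ltr_pdivlMr//.
  have phw : phi ((x + y) / 2) <= phi w by apply: le_phi;
    rewrite normf_div (ger0_norm (_ : 0 <= 2)).
  apply: lt_le_trans phw.
  rewrite -(@ltr_pXn2r _ 2)// ?nnegrE ?mulr_ge0 ?ltW//.
  apply: lt_le_trans (fg x y).
  rewrite exprMn gaE.
  rewrite ltr_pdivlMr// in tf; rewrite ltr_pdivlMr// in tg.
  have -> : t ^+ 2 * (al * be) = (t * al) * (t * be) by ring.
  by rewrite ltr_pM// mulr_ge0// ltW.
have nE (p : R -> R) : measurable_fun setT p -> (forall x, 0 <= p x) ->
    (\int[normal_prob 0%R 1%R]_x (p x)%:E = \int[lam]_x (p x * phi x)%:E)%E.
  move=> mp p0; rewrite ge0_integral_normal_prob.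
  - by apply: eq_integral => x _; rewrite mulrC EFinM.
  - exact/measurable_EFinP.
  - by move=> x; rewrite lee_fin.
have scale (p : R -> R) (c : R) : measurable_fun setT p -> (forall x, 0 <=
  p x) -> 0 < c ->
    (\int[lam]_x (p x / c)%:E = c^-1%:E * \int[lam]_x (p x)%:E)%E.
  move=> mp p0 c0; rewrite -ge0_integralZl//.
  - by apply: eq_integral => x _; rewrite mulrC EFinM.
  - exact/measurable_EFinP.
  - by move=> x _; rewrite lee_fin.
  - by rewrite lee_fin invr_ge0 ltW.
rewrite !nE// -/f -/g.
move: key; rewrite /pf /pg /ph !scale//; last 2 first.
- exact: measurable_normal_pdf.
- by move=> x; rewrite ltW.
rewrite integral_normal_pdf mule1.
have If0 : (0 <= \int[lam]_x (f x)%:E)%E by apply: integral_ge0 => x _;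
  rewrite lee_fin.
have Ig0 : (0 <= \int[lam]_x (g x)%:E)%E by apply: integral_ge0 => x _;
  rewrite lee_fin.
change (\int[lam]_x (F x * phi x)%:E)%E with (\int[lam]_x (f x)%:E)%E.
change (\int[lam]_x (G x * phi x)%:E)%E with (\int[lam]_x (g x)%:E)%E.
move: If0 Ig0.
case: (\int[lam]_x (f x)%:E)%E => [a||]// a0; last first.
  case: (\int[lam]_x (g x)%:E)%E => [b||]// b0.
    by rewrite gt0_muley ?lte_fin ?invr_gt0// -EFinM.
  by rewrite !gt0_muley ?lte_fin ?invr_gt0// -EFinM.
case: (\int[lam]_x (g x)%:E)%E => [b||]// b0; last first.
  by rewrite [X in (_ + X)%E]gt0_muley ?lte_fin ?invr_gt0// -!EFinM.
rewrite !lee_fin in a0 b0; rewrite -!EFinM -EFinD !lee_fin => h.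
have s0 : 0 <= al^-1 * a + be^-1 * b by rewrite addr_ge0// mulr_ge0// invr_ge0
  ltW.
(* For the integrals a and b: 4 (a / al) (b / be) <= (a / al + b / be)^2 <= 4 / (al be). Since [ga]
   is the geometric mean, the suprema cancel and a b <= 1. *)
have h2 : (al^-1 * a + be^-1 * b) ^+ 2 <= (2 / ga) ^+ 2.
  by rewrite lerXn2r ?nnegrE// divr_ge0// ltW.
have h3 : 4 * ((al^-1 * a) * (be^-1 * b)) <= (al^-1 * a + be^-1 * b) ^+ 2.
  rewrite -subr_ge0 (_ : _ - _ = (al^-1 * a - be^-1 * b) ^+ 2) ?sqr_ge0//; ring.
have := le_trans h3 h2; rewrite exprMn exprVn gaE.
rewrite -(@ler_pM2r _ (al * be)) ?mulr_gt0//.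
rewrite (_ : _ / _ * _ = 4); last by field; rewrite !gt_eqF.
rewrite (_ : 4 * _ * _ = 4 * (a * b)); last by field; rewrite !gt_eqF.
lra.
Qed.

End prekopa_leindler.

(** * Property (tau) in every dimension, and medians *)

Section gaussian_transport.
Context (R : realType).
Local Open Scope ereal_scope.

(** In the induction on the dimension, F and G are partial integrals and may a priori be infinite.
    If one vanishes identically the product is 0; otherwise a positive value of each forces the
    other to be finite. *)
Lemma gauss_transport1 (F G : R -> \bar R) :
  measurable_fun setT F -> measurable_fun setT G ->
  (forall x, 0 <= F x) -> (forall x, 0 <= G x) ->
  (forall x y, F x * G y <= (expR ((x - y) ^+ 2 / 4))%:E) ->
  \int[normal_prob 0%R 1%R]_x F x * \int[normal_prob 0%R 1%R]_x G x <= 1.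
Proof.
move=> mF mG F0 G0 FG.
have [[x0 Fx0]|nF] := pselect (exists x, 0 < F x); last first.
  rewrite [X in X * _]integral0_eq ?mul0e// => x _; apply/eqP.
  by rewrite eq_le F0 andbT leNgt; apply/negP => Fx; apply: nF; exists x.
have [[y0 Gy0]|nG] := pselect (exists y, 0 < G y); last first.
  rewrite [X in _ * X]integral0_eq ?mule0// => x _; apply/eqP.
  by rewrite eq_le G0 andbT leNgt; apply/negP => Gx; apply: nG; exists x.
have Ffin x : F x = (fine (F x))%:E.
  have := FG x y0; have := F0 x; case: (F x) => [r||]//.
  by rewrite gt0_mulye.
have Gfin y : G y = (fine (G y))%:E.
  have := FG x0 y; have := G0 y; case: (G y) => [r||]//.
  by rewrite gt0_muley.
have FE : F = EFin \o (fine \o F) by apply/funext => x; exact: Ffin.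
have GE : G = EFin \o (fine \o G) by apply/funext => x; exact: Gfin.
rewrite {1}FE {1}GE.
apply: gauss_transport_real.
- exact: measurableT_comp.
- exact: measurableT_comp.
- by move=> x; rewrite fine_ge0.
- by move=> x; rewrite fine_ge0.
- by move=> x y; have := FG x y; rewrite Ffin Gfin -EFinM lee_fin.
- by exists x0; rewrite -lte_fin -Ffin.
- by exists y0; rewrite -lte_fin -Gfin.
Qed.

Lemma dot_cons_rowB n (x y : R) (v w : 'rV[R]_n) :
  (dot ((cons_row (x, v) : 'rV_n.+1) - cons_row (y, w))
       ((cons_row (x, v) : 'rV_n.+1) - cons_row (y, w)) =
  (x - y) ^+ 2 + dot (v - w) (v - w))%R.
Proof.
have -> : ((cons_row (x, v) : 'rV_n.+1) - cons_row (y, w) =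
  cons_row ((x - y)%R, (v - w)%R) :> 'rV_n.+1)%R.
  apply/rowP => i; have [->|[j ->]] : i = 0%R \/ exists j, i = lift ord0 j.
    by case: (unliftP ord0 i) => [j ->|->]; [right; exists j|left].
  - by rewrite [RHS]cons_row0 mxE cons_row0 mxE cons_row0.
  - by rewrite [RHS]cons_rowS mxE cons_rowS mxE cons_rowS !mxE.
rewrite /dot big_ord_recl cons_row0 expr2; congr (_ + _)%R.
by apply: eq_bigr => i _; rewrite cons_rowS.
Qed.

(* Maurey's property (tau) in its two-function form; it tensorizes by
   integrating out one coordinate at a time. *)
Lemma gauss_transport n (F G : borel R n -> \bar R) :
  measurable_fun setT F -> measurable_fun setT G ->
  (forall x, 0 <= F x) -> (forall x, 0 <= G x) ->
  (forall x y, F x * G y <=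
    (expR (dot ((x : 'rV_n) - y) ((x : 'rV_n) - y) / 4))%:E) ->
  \int[gauss R n]_x F x * \int[gauss R n]_x G x <= 1.
Proof.
elim: n F G => [|n IH] F G mF mG F0 G0 FG.
  rewrite !integral_gauss0//; apply: le_trans (FG _ _) _.
  by rewrite /dot big_ord0 mul0r expR0.
rewrite !ge0_integral_gaussS//; apply: gauss_transport1.
- exact: measurable_integral_gauss.
- exact: measurable_integral_gauss.
- by move=> x; exact: integral_ge0.
- by move=> x; exact: integral_ge0.
(* With the first coordinates fixed at x and y, their share [c] of the exponential is divided out of
   F, and the induction hypothesis applies to the remaining coordinates. *)
move=> x y; set c := expR _.
have c0 : (0 < c)%R by exact: expR_gt0.
have mFx : measurable_fun setT (fun v : borel R n => F (cons_row (x, v))).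
  exact: (measurableT_comp mF (measurable_cons_row1 x)).
have mGy : measurable_fun setT (fun v : borel R n => G (cons_row (y, v))).
  exact: (measurableT_comp mG (measurable_cons_row1 y)).
have cF0 v : 0 <= c^-1%:E * F (cons_row (x, v)).
  by rewrite mule_ge0// lee_fin invr_ge0 ltW.
have mcF : measurable_fun setT (fun v : borel R n => c^-1%:E * F (cons_row (x,
  v))).
  exact: emeasurable_funM.
have := IH _ _ mcF mGy cF0 (fun v => G0 _).
have : forall v w : borel R n, c^-1%:E * F (cons_row (x, v)) * G (cons_row (y,
  w)) <=
    (expR (dot ((v : 'rV_n) - w) ((v : 'rV_n) - w) / 4))%:E.
  move=> v w; rewrite -muleA lee_pdivrMl// -EFinM.
  apply: le_trans (FG _ _) _; rewrite lee_fin /c -expRD ler_expR -mulrDl.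
  by rewrite ler_pM2r ?invr_gt0// dot_cons_rowB.
move=> h /(_ h); rewrite ge0_integralZl//; last by rewrite lee_fin invr_ge0 ltW.
by rewrite -muleA lee_pdivrMl// mule1.
Qed.

Lemma prob_bigcap_ge d (T : measurableType d) (P : probability T R)
    (A : (set T)^nat) (c : R) : (forall k, measurable (A k)) ->
  nonincreasing_seq A -> (forall k, c%:E <= P (A k)) ->
  c%:E <= P (\bigcap_k A k).
Proof.
move=> mA ndA cA.
have cv : P \o A @ \oo --> P (\bigcap_k A k).
  apply: nonincreasing_cvg_mu => //.
  - by rewrite (le_lt_trans (probability_le1 _ _))// ltry.
  - exact: bigcapT_measurable.
rewrite -(cvg_lim _ cv)//; apply: lime_ge; first by apply/cvg_ex; eexists;
  exact: cv.
exact: nearW.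
Qed.

(** M is the infimum of the levels t with P(f <= t) >= 1/2. Both inequalities pass to the limit
    along decreasing events, at M + 1/(k+1) and M - 1/(k+1). The set of levels is nonempty and
    bounded below because otherwise tail events with empty intersection would keep probability
    1/2. *)
Lemma prob_median d (T : measurableType d) (P : probability T R) (f : T -> R) :
  measurable_fun setT f -> exists M : R,
    2^-1%:E <= P [set x | (f x <= M)%R] /\ 2^-1%:E <= P [set x | (M <= f x)%R].
Proof.
move=> mf.
have mle t : measurable [set x | (f x <= t)%R].
  rewrite (_ : [set x | _] = f @^-1` `]-oo, t]%classic).
    by rewrite -[X in measurable X]setTI; exact: mf.
  by apply/seteqP; split => x /=; rewrite in_itv.
have mlt t : measurable [set x | (t < f x)%R].
  rewrite (_ : [set x | _] = f @^-1` `]t, +oo[%classic).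
    by rewrite -[X in measurable X]setTI; exact: mf.
  by apply/seteqP; split => x /=; rewrite in_itv/= andbT.
have leC t : [set x | (t < f x)%R] = ~` [set x | (f x <= t)%R].
  by apply/seteqP; split => x /=; rewrite ltNge => /negP.
have half t : P [set x | (f x <= t)%R] < 2^-1%:E -> 2^-1%:E <=
  P [set x | (t < f x)%R].
  move=> lt; rewrite leC probability_setC//.
  have Pf : P [set x | (f x <= t)%R] \is a fin_num by exact: fin_num_measure.
  move: lt; rewrite -(fineK Pf) -EFinB lte_fin lee_fin; lra.
pose S := [set t : R | 2^-1%:E <= P [set x | (f x <= t)%R]].
have S0 : S !=set0.
  apply: contrapT => nS.
  have : 2^-1%:E <= P (\bigcap_k [set x | (k%:R < f x)%R]).
    apply: prob_bigcap_ge => //.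
    - move=> a b ab; apply/subsetPset => x /=; apply: le_lt_trans.
      by rewrite ler_nat.
    - move=> k; apply: half; rewrite ltNge; apply/negP => h; apply: nS.
      by exists k%:R.
  rewrite (_ : \bigcap_k _ = set0);
    first by rewrite measure0 lee_fin leNgt invr_gt0 ltr0n.
  apply/seteqP; split => // x /= h.
  have := h (Num.trunc (Num.max (f x) 0)%R).+1 I.
  rewrite /= ltNge => /negP; apply; apply: ltW.
  by rewrite (le_lt_trans _ (truncnS_gt _))// le_max lexx.
have lbS : has_lbound S.
  apply: contrapT => nS.
  have nbd (k : nat) : exists2 t, S t & (t < - k%:R)%R.
    apply: contrapT => h; apply: nS; exists (- k%:R)%R => t St.
    by rewrite leNgt; apply/negP => lt; apply: h; exists t.
  have : 2^-1%:E <= P (\bigcap_k [set x | (f x <= - k%:R)%R]).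
    apply: prob_bigcap_ge => //.
    - move=> a b ab; apply/subsetPset => x /= /le_trans; apply.
      by rewrite lerN2 ler_nat.
    - move=> k; have [t St tk] := nbd k.
      apply: le_trans St _; apply: le_measure; rewrite ?inE//.
      by move=> x /= /le_trans; apply; exact: ltW.
  rewrite (_ : \bigcap_k _ = set0);
    first by rewrite measure0 lee_fin leNgt invr_gt0 ltr0n.
  apply/seteqP; split => // x /= h.
  have := h (Num.trunc (Num.max (- f x) 0)%R).+1 I.
  rewrite /= lerNr => /(lt_le_trans (truncnS_gt _)).
  by rewrite gt_max ltxx.
have hS : has_inf S by [].
exists (inf S); split.
- have -> : [set x | (f x <= inf S)%R] = \bigcap_k [set x | (f x <=
  inf S + k.+1%:R^-1)%R].
    apply/seteqP; split => x /= h.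
      by move=> k _ /=; rewrite (le_trans h)// lerDl.
    apply/ler_addgt0Pr => e e0.
    have [k ke] : exists k : nat, (k.+1%:R^-1 < e)%R.
      exists (Num.trunc e^-1); rewrite -[ltRHS]invrK ltf_pV2 ?posrE ?invr_gt0//.
      exact: truncnS_gt.
    by apply: le_trans (h k I) _; rewrite lerD2l ltW.
  apply: prob_bigcap_ge => //.
  + move=> a b ab; apply/subsetPset => x /= /le_trans; apply.
    by rewrite lerD2l lef_pV2 ?posrE// ler_nat ltnS.
  + move=> k; have : (inf S < inf S + k.+1%:R^-1)%R by rewrite ltrDl.
    move=> /(inf_lt S0)[t St tk].
    apply: le_trans St _; apply: le_measure; rewrite ?inE//.
    by move=> x /= /le_trans; apply; exact: ltW.
- have -> : [set x | (inf S <= f x)%R] =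
  \bigcap_k [set x | (inf S - k.+1%:R^-1 < f x)%R].
    apply/seteqP; split => x /= h.
      by move=> k _ /=; rewrite (lt_le_trans _ h)// ltrBlDr ltrDl.
    apply/ler_addgt0Pr => e e0.
    have [k ke] : exists k : nat, (k.+1%:R^-1 < e)%R.
      exists (Num.trunc e^-1); rewrite -[ltRHS]invrK ltf_pV2 ?posrE ?invr_gt0//.
      exact: truncnS_gt.
    by have := h k I; rewrite /= ltrBlDr => /ltW/le_trans; apply;
      rewrite lerD2l ltW.
  apply: prob_bigcap_ge => //.
  + move=> a b ab; apply/subsetPset => x /=; apply: le_lt_trans.
    by rewrite lerD2l lerN2 lef_pV2 ?posrE// ler_nat ltnS.
  + move=> k; apply: half; rewrite ltNge; apply/negP => h.
    have : (inf S <= inf S - k.+1%:R^-1)%R by apply: ge_inf.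
    by apply/negP; rewrite -ltNge ltrBlDr ltrDl.
Qed.

End gaussian_transport.

(** * Concentration of Lipschitz functions around a median *)

Section lipschitz_concentration.
Context (R : realType) (n : nat).
Local Open Scope ereal_scope.

(** Property (tau) with G the indicator of {f <= M}, of mean at least 1/2: if f y <= M, then the
    positive part of f x - M is at most L |x - y|. *)
Lemma gauss_half_concentration (f : borel R n -> R) (L M : R) : (0 < L)%R ->
  measurable_fun setT f ->
  (forall x y, f x - f y <= L * enorm ((x : 'rV_n) - y))%R ->
  2^-1%:E <= gauss R n [set x | (f x <= M)%R] ->
  \int[gauss R n]_x (expR (Num.max (f x - M) 0 ^+ 2 / (4 * L ^+ 2)))%:E <= 2%:E.
Proof.
move=> L0 mf lip med.
have mA : measurable [set x | (f x <= M)%R].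
  rewrite (_ : [set x | _] = f @^-1` `]-oo, M]%classic).
    by rewrite -[X in measurable X]setTI; exact: mf.
  by apply/seteqP; split => x /=; rewrite in_itv.
have mF : measurable_fun setT
    (fun x => (expR (Num.max (f x - M) 0 ^+ 2 / (4 * L ^+ 2)))%:E).
  apply/measurable_EFinP; apply: (measurableT_comp (@measurable_expR R)).
  apply: measurable_funM => //; apply: measurable_funX.
  by apply: measurable_maxr => //; exact: measurable_funB.
have mG : measurable_fun setT (fun x => (\1_[set x | (f x <=
  M)%R] x)%:E : \bar R).
  by apply/measurable_EFinP; exact: measurable_indic.
have F0 x : 0 <= (expR (Num.max (f x - M) 0 ^+ 2 / (4 * L ^+ 2)))%:E.
  by rewrite lee_fin expR_ge0.
have G0 x : 0 <= (\1_[set x | (f x <= M)%R] x)%:E :> \bar R by rewrite lee_fin.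
have := gauss_transport mF mG F0 G0.
rewrite integral_indic// setIT.
set I := \int[_]_x _; have I0 : 0 <= I by exact: integral_ge0.
move=> /(_ _)/wrap[|h].
  move=> x y; rewrite -EFinM lee_fin indicE.
  case: (boolP (y \in _)) => [/set_mem/= yM|_]; last by rewrite mulr0 expR_ge0.
  rewrite mulr1 ler_expR ler_pdivrMr ?mulr_gt0 ?exprn_gt0//.
  rewrite [leRHS](_ : _ = (L * enorm ((x : 'rV_n) - y)) ^+ 2)%R; last first.
    by rewrite exprMn /enorm sqr_sqrtr ?dot_self_ge0//; field.
  apply: lerXn2r; rewrite ?nnegrE ?le_max ?lexx ?orbT//.
    by rewrite mulr_ge0 ?sqrtr_ge0// ltW.
  rewrite ge_max mulr_ge0 ?sqrtr_ge0 ?(ltW L0)// andbT.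
  by apply: le_trans (lip x y); rewrite lerD2l lerN2.
have : I * 2^-1%:E <= 1 by apply: le_trans h; exact: lee_wpmul2l.
by rewrite lee_pdivrMr// mul1e.
Qed.

Lemma expR_sqr_bound (t : R) : (0 <= t -> t ^+ 2 <= 4 * (expR t - 1))%R.
Proof.
move=> t0; have h := expR_ge1Dx (t / 2).
have : ((1 + t / 2) ^+ 2 <= expR (t / 2) ^+ 2)%R.
  by apply: lerXn2r; rewrite ?nnegrE ?expR_ge0// addr_ge0// divr_ge0.
have <- : (expR t = expR (t / 2) ^+ 2)%R by rewrite -expRM_natl; congr expR;
  field.
by nra.
Qed.

(** Apply the one-sided bound to f at M and to -f at -M. With t = (f - M)^2 / (4 L^2), one of the
    two exponentials is exp t and the other is 1, while (f - M)^4 = 16 L^4 t^2 <= 64 L^4 (exp t -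
    1). Taking means gives 64 L^4 (2 + 2 - 2) = 128 L^4. *)
Lemma gauss_lipschitz_moment4 (f : borel R n -> R) (L : R) : (0 < L)%R ->
  measurable_fun setT f ->
  (forall x y, f x - f y <= L * enorm ((x : 'rV_n) - y))%R ->
  exists M : R, \int[gauss R n]_x ((f x - M) ^+ 4)%:E <= (128 * L ^+ 4)%:E.
Proof.
move=> L0 mf lip; have [M [med1 med2]] := prob_median (gauss R n) mf.
exists M.
pose Fp x := (expR (Num.max (f x - M) 0 ^+ 2 / (4 * L ^+ 2)))%R.
pose Fm x := (expR (Num.max (- f x - - M) 0 ^+ 2 / (4 * L ^+ 2)))%R.
have hp : \int[gauss R n]_x (Fp x)%:E <=
  2%:E by exact: gauss_half_concentration.
have mNf : measurable_fun setT (fun x => - f x)%R by exact: measurableT_comp.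
have hm : \int[gauss R n]_x (Fm x)%:E <= 2%:E.
  apply: (gauss_half_concentration L0 mNf).
    move=> x y; rewrite opprK addrC; apply: le_trans (lip y x) _.
    rewrite /enorm (_ : dot _ _ = dot ((x : 'rV_n) - y) ((x : 'rV_n) - y))%R//.
    by apply: eq_bigr => i _; rewrite !mxE; ring.
  apply: le_trans med2 _; apply: le_measure; rewrite ?inE.
  - rewrite (_ : [set x | _] = f @^-1` `[M, +oo[%classic).
      by rewrite -[X in measurable X]setTI; exact: mf.
    by apply/seteqP; split => x /=; rewrite in_itv/= andbT.
  - rewrite (_ : [set x | _] = f @^-1` `[M, +oo[%classic).
      by rewrite -[X in measurable X]setTI; exact: mf.
    by apply/seteqP; split => x /=; rewrite in_itv/= andbT lerN2.
  - by move=> x /=; rewrite lerN2.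
have mFp : measurable_fun setT (fun x => (Fp x)%:E).
  apply/measurable_EFinP; apply: (measurableT_comp (@measurable_expR R)).
  apply: measurable_funM => //; apply: measurable_funX.
  by apply: measurable_maxr => //; exact: measurable_funB.
have mFm : measurable_fun setT (fun x => (Fm x)%:E).
  apply/measurable_EFinP; apply: (measurableT_comp (@measurable_expR R)).
  apply: measurable_funM => //; apply: measurable_funX.
  by apply: measurable_maxr => //; exact: measurable_funB.
have Fp0 x : 0 <= (Fp x)%:E by rewrite lee_fin expR_ge0.
have Fm0 x : 0 <= (Fm x)%:E by rewrite lee_fin expR_ge0.
have L4 : (0 <= 64 * L ^+ 4)%R by rewrite mulr_ge0// exprn_ge0// ltW.
have L2 : (0 < 4 * L ^+ 2)%R by rewrite mulr_gt0// exprn_gt0.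
have m4 : measurable_fun setT (fun x => ((f x - M) ^+ 4)%:E).
  by apply/measurable_EFinP/measurable_funX/measurable_funB.
have f40 x : 0 <= ((f x - M) ^+ 4)%:E.
  by rewrite lee_fin (exprM _ 2 2) sqr_ge0.
have pw x : ((f x - M) ^+ 4 + 128 * L ^+ 4 <= 64 * L ^+ 4 * (Fp x + Fm x))%R.
  pose t := ((f x - M) ^+ 2 / (4 * L ^+ 2))%R.
  have t0 : (0 <= t)%R by rewrite divr_ge0 ?sqr_ge0// ltW.
  have FE : (Fp x + Fm x = expR t + 1)%R.
    rewrite /Fp /Fm /t (_ : - f x - - M = - (f x - M))%R; last by ring.
    have [h|h] := leP 0%R (f x - M)%R.
      have -> : Num.max (- (f x - M))%R 0%R = 0%R by rewrite max_r// oppr_le0.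
      by rewrite expr0n mul0r expR0.
    have -> : Num.max (- (f x - M))%R 0%R = (- (f x - M))%R.
      by rewrite max_l// oppr_ge0 ltW.
    by rewrite expr0n mul0r expR0 addrC sqrrN.
  have := expR_sqr_bound t0.
  have -> : ((f x - M) ^+ 4 = 16 * L ^+ 4 * t ^+ 2)%R.
    by rewrite /t; field; rewrite gt_eqF.
  rewrite FE => h.
  have L40 : (0 <= 16 * L ^+ 4)%R by rewrite mulr_ge0// exprn_ge0// ltW.
  have := ler_wpM2l L40 h; lra.
have L128 : (0 <= 128 * L ^+ 4)%R by rewrite mulr_ge0// exprn_ge0// ltW.
have : \int[gauss R n]_x (((f x - M) ^+ 4)%:E + 1%:E * (128 * L ^+ 4)%:E) <=
   (64 * L ^+ 4)%:E * (\int[gauss R n]_x (Fp x)%:E + \int[gauss R n]_x (Fm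
     x)%:E).
  rewrite -ge0_integralD// -ge0_integralZl//; last 2 first.
  - exact: emeasurable_funD.
  - by move=> x _; rewrite adde_ge0.
  apply: ge0_le_integral_nonmeasurable => x.
    by rewrite mul1e adde_ge0.
  by rewrite mul1e -!EFinD -EFinM lee_fin.
rewrite ge0_integralDZ// integral_gauss_cst mul1e.
move=> /le_trans/(_ (lee_wpmul2l _ (leeD hp hm))); rewrite lee_fin => /(_ L4).
rewrite -EFinD -EFinM.
have I0 : 0 <= \int[gauss R n]_x ((f x - M) ^+ 4)%:E by exact: integral_ge0.
move: I0; case: (\int[gauss R n]_x ((f x - M) ^+ 4)%:E) => [r||]//.
by rewrite -EFinD !lee_fin => _; lra.
Qed.

End lipschitz_concentration.

(** * Norms and the constrained minimizer *)

Section euclidean.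
Context (R : realType) (n : nat).
Implicit Types x y z : 'rV[R]_n.

Lemma dotC x y : dot x y = dot y x.
Proof. by apply: eq_bigr => i _; rewrite mulrC. Qed.

Lemma dotDl x y z : dot (x + y) z = dot x z + dot y z.
Proof. by rewrite -big_split; apply: eq_bigr => i _; rewrite mxE mulrDl. Qed.

Lemma dotZl (c : R) x y : dot (c *: x) y = c * dot x y.
Proof. by rewrite mulr_sumr; apply: eq_bigr => i _; rewrite mxE mulrA. Qed.

Lemma dot0l y : dot 0 y = 0.
Proof. by rewrite -(scale0r 0) dotZl mul0r. Qed.

Lemma dotNl x y : dot (- x) y = - dot x y.
Proof. by rewrite -scaleN1r dotZl mulN1r. Qed.

Lemma dotBl x y z : dot (x - y) z = dot x z - dot y z.
Proof. by rewrite dotDl dotNl. Qed.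

Lemma dotDr x y z : dot x (y + z) = dot x y + dot x z.
Proof. by rewrite dotC dotDl !(dotC _ x). Qed.

Lemma dotZr (c : R) x y : dot x (c *: y) = c * dot x y.
Proof. by rewrite dotC dotZl dotC. Qed.

Lemma dotNr x y : dot x (- y) = - dot x y.
Proof. by rewrite dotC dotNl dotC. Qed.

Lemma dotBr x y z : dot x (y - z) = dot x y - dot x z.
Proof. by rewrite dotDr dotNr. Qed.

Lemma dot_eq0 x : dot x x = 0 -> x = 0.
Proof.
move=> /eqP; rewrite psumr_eq0; last by move=> i _; rewrite -expr2 sqr_ge0.
move=> /allP xi; apply/rowP => i; rewrite mxE; apply/eqP.
by have := xi i (mem_index_enum _); rewrite -expr2 sqrf_eq0.
Qed.

Lemma enorm_ge0 x : 0 <= enorm x. Proof. exact: sqrtr_ge0. Qed.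

Lemma sqr_enorm x : enorm x ^+ 2 = dot x x.
Proof. by rewrite sqr_sqrtr// dot_self_ge0. Qed.

Lemma enorm_eq0 x : enorm x = 0 -> x = 0.
Proof. by move=> x0; apply: dot_eq0; rewrite -sqr_enorm x0 expr0n. Qed.

Lemma enormZ (c : R) x : enorm (c *: x) = `|c| * enorm x.
Proof.
by rewrite /enorm dotZl dotZr mulrA -expr2 sqrtrM ?sqr_ge0// sqrtr_sqr.
Qed.

Lemma le_dot_enorm x y : dot x y <= enorm x * enorm y.
Proof.
have [x0|x0] := eqVneq (enorm x) 0.
  by rewrite x0 mul0r (enorm_eq0 x0) -(scale0r y) dotZl mul0r.
have [y0|y0] := eqVneq (enorm y) 0.
  by rewrite y0 mulr0 (enorm_eq0 y0) -(scale0r x) dotZr mul0r.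
have xp : 0 < enorm x by rewrite lt_def x0 enorm_ge0.
have yp : 0 < enorm y by rewrite lt_def y0 enorm_ge0.
have := dot_self_ge0 (enorm y *: x - enorm x *: y).
rewrite !(dotBl, dotBr, dotZl, dotZr) -!sqr_enorm (dotC y x).
rewrite (_ : _ - _ = 2 * (enorm x * enorm y) * (enorm x * enorm y - dot x y));
  last by ring.
by rewrite pmulr_rge0 ?mulr_gt0// subr_ge0.
Qed.

Lemma norm_coord_le x i : `|x 0 i| <= enorm x.
Proof.
rewrite -(@ler_pXn2r _ 2)// ?nnegrE ?enorm_ge0// sqr_enorm real_normK
  ?num_real//.
rewrite /dot (bigD1 i)//= -expr2 lerDl sumr_ge0// => j _.
by rewrite -expr2 sqr_ge0.
Qed.

Lemma continuous_enorm : continuous (@enorm R n).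
Proof.
move=> x; apply: (continuous_comp (@continuous_dot_self R n x)).
exact: sqrt_continuous.
Qed.

Lemma mx_norm_le_enorm x : `|x| <= enorm x.
Proof.
rewrite -[leLHS]/(mx_norm x) mx_normrE; apply/bigmax_leP; split;
  first exact: enorm_ge0.
by move=> [i j] _ /=; rewrite ord1 norm_coord_le.
Qed.

Lemma compact_sphere : compact [set x : 'rV[R]_n | enorm x = 1].
Proof.
apply: bounded_closed_compact.
  exists 1; split; first exact: num_real.
  by move=> M M1 x /= x1; apply: le_trans (mx_norm_le_enorm x) _;
    rewrite x1 ltW.
by apply: (@closed_comp _ _ (@enorm R n) [set x | x = 1]) => [x _|];
  [exact: continuous_enorm|exact: closed_eq].
Qed.

Lemma compact_enorm_ball (c : 'rV[R]_n) (rho : R) :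
  compact [set x : 'rV[R]_n | enorm (c - x) ^+ 2 <= rho].
Proof.
have cc : continuous (fun x : 'rV[R]_n => enorm (c - x) ^+ 2).
  move=> x; under eq_fun do rewrite sqr_enorm.
  apply: (@continuous_comp _ _ _ (fun x : 'rV[R]_n => c - x) (fun y => dot y
    y)).
    by apply: continuousB; [exact: cst_continuous|exact: id].
  exact: continuous_dot_self.
apply: bounded_closed_compact.
  exists (`|c| + Num.sqrt rho); split; first exact: num_real.
  move=> M ltM x /= xr; apply: le_trans (ltW ltM).
  rewrite -[x](subKr c); apply: le_trans (ler_normB _ _) _; rewrite lerD2l.
  apply: le_trans (mx_norm_le_enorm _) _.
  by rewrite -(ger0_norm (enorm_ge0 (c - x))) -sqrtr_sqr ler_wsqrtr.
by apply: (@closed_comp _ _ (fun x : 'rV[R]_n => enorm (c - x) ^+ 2) [set x |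
  x <= rho]) => [x _|]; [exact: cc|exact: closed_le].
Qed.

End euclidean.

(** * Norms, dual norms and projection onto a ball *)

Section norms.
Context (R : realType) (n : nat) (K : 'rV[R]_n -> R).
Hypothesis KN : is_norm K.
Implicit Types x y z : 'rV[R]_n.

Let K_ge0 x : 0 <= K x. Proof. by case: KN. Qed.
Let K_eq0 x : K x = 0 -> x = 0. Proof. by case: KN => _ + _ _; apply. Qed.
Let KZ (c : R) x : K (c *: x) = `|c| * K x. Proof. by case: KN. Qed.
Let KD x y : K (x + y) <= K x + K y. Proof. by case: KN. Qed.

Lemma is_norm0 : K 0 = 0.
Proof. by rewrite -(scale0r 0) KZ normr0 mul0r. Qed.

Lemma is_normN x : K (- x) = K x.
Proof. by rewrite -scaleN1r KZ normrN1 mul1r. Qed.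

Lemma is_norm_gt0 x : x != 0 -> 0 < K x.
Proof. by move=> x0; rewrite lt_def K_ge0 andbT;
  apply: contra_neq x0 => /K_eq0. Qed.

Lemma is_normB x y : K (x - y) <= K x + K y.
Proof. by apply: le_trans (KD _ _) _; rewrite is_normN. Qed.

Lemma is_norm_distr x y : K x - K y <= K (x - y).
Proof. by rewrite lerBlDr; apply: le_trans (KD _ _); rewrite subrK. Qed.

Let Ke : R := \sum_i K (delta_mx 0 i).

Let Ke_ge0 : 0 <= Ke. Proof. exact: sumr_ge0. Qed.

Let K_sum x : K x <= \sum_i `|x 0 i| * K (delta_mx 0 i).
Proof.
rewrite {1}(row_sum_delta x).
elim/big_ind2 : _ => [|a u b v au bv|i _]; first by rewrite is_norm0.
- by apply: le_trans (KD _ _) _; rewrite lerD.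
- by rewrite KZ.
Qed.

Lemma is_norm_le_enorm : exists2 C : R, 0 <= C & forall x, K x <= C * enorm x.
Proof.
exists Ke => // x; apply: le_trans (K_sum x) _.
by rewrite mulr_suml ler_sum// => i _; rewrite mulrC ler_wpM2l// norm_coord_le.
Qed.

Lemma continuous_is_norm : continuous K.
Proof.
have coord x i : `|x 0 i| <= `|x|.
  by rewrite -[leRHS]/(mx_norm x) mx_normrE; apply/bigmax_geP; right;
    exists (0, i).
have Kle x : K x <= Ke * `|x|.
  apply: le_trans (K_sum x) _; rewrite mulr_suml ler_sum// => i _.
  by rewrite mulrC ler_wpM2l.
move=> x; suff H : K @ nbhs x --> K x by exact: H.
apply/(@cvgrPdist_le _ _ _ (nbhs x)) => e e_gt0.
apply: (@nbhs_normP R 'rV[R]_n x (fun y => `|K x - K y| <= e)).2.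
exists (e / (Ke + 1)) => /=; first by rewrite divr_gt0// ltr_wpDl.
move=> y /= /ltW xy.
have h : Ke * `|x - y| <= e.
  apply: le_trans (ler_wpM2l Ke_ge0 xy) _.
  by rewrite mulrCA ler_piMr ?(ltW e_gt0)// ler_pdivrMr ?ltr_wpDl// mul1r lerDl.
rewrite ler_norml lerNl opprB; apply/andP; split.
  apply: le_trans (is_norm_distr _ _) _.
  by rewrite -is_normN opprB; apply: le_trans (Kle _) h.
by apply: le_trans (is_norm_distr _ _) _; apply: le_trans (Kle _) h.
Qed.

Lemma measurable_is_norm : measurable_fun setT (K : borel R n -> R).
Proof. by apply: continuous_borel; exact: continuous_is_norm. Qed.

Hypothesis n0 : (0 < n)%N.

Let e0 : 'rV[R]_n := delta_mx 0 (Ordinal n0).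

Let e0_neq0 : e0 != 0.
Proof.
apply/eqP => /matrixP/(_ 0 (Ordinal n0)); rewrite !mxE !eqxx => /eqP.
by rewrite oner_eq0.
Qed.

Let sphere_nonempty : [set x : 'rV[R]_n | enorm x = 1] !=set0.
Proof.
exists ((enorm e0)^-1 *: e0) => /=;
  rewrite enormZ ger0_norm ?invr_ge0 ?enorm_ge0//.
by rewrite mulVf//; apply: contra_neq e0_neq0 => /enorm_eq0.
Qed.

Let normalize x : x != 0 -> exists2 u, enorm u = 1 & x = enorm x *: u.
Proof.
move=> x0; have e : enorm x != 0 by apply: contra_neq x0 => /enorm_eq0.
exists ((enorm x)^-1 *: x); last by rewrite scalerA divff// scale1r.
by rewrite enormZ ger0_norm ?invr_ge0 ?enorm_ge0// mulVf.
Qed.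

Lemma enorm_le_is_norm : exists2 c : R, 0 < c & forall x, c * enorm x <= K x.
Proof.
have [u /set_mem u1 minu] := EVT_min_rV sphere_nonempty (@compact_sphere R n)
  (continuous_subspaceT continuous_is_norm).
exists (K u).
  apply: is_norm_gt0; apply/eqP => u0; move: u1.
  by rewrite /= u0 -(scale0r 0) enormZ normr0 mul0r => /esym/eqP;
    rewrite oner_eq0.
move=> x; have [->|/normalize[v v1 xE]] := eqVneq x 0.
  by rewrite is_norm0 -(scale0r 0) enormZ normr0 mul0r mulr0.
rewrite {2}xE KZ ger0_norm ?enorm_ge0// mulrC ler_wpM2l ?enorm_ge0//.
by apply: minu; exact: mem_set.
Qed.

Lemma is_norm_sphere_max :
  exists2 u, enorm u = 1 & forall x, K x <= K u * enorm x.
Proof.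
have [u /set_mem u1 maxu] := EVT_max_rV sphere_nonempty (@compact_sphere R n)
  (continuous_subspaceT continuous_is_norm).
exists u => // x; have [->|/normalize[v v1 xE]] := eqVneq x 0.
  by rewrite is_norm0 mulr_ge0 ?enorm_ge0.
rewrite {1}xE KZ ger0_norm ?enorm_ge0// mulrC ler_wpM2r ?enorm_ge0//.
by apply: maxu; exact: mem_set.
Qed.

Let dual_set x := [set dot x y / K y | y in [set y | y != 0]].

Let dual_has_sup x : has_sup (dual_set x).
Proof.
split; first by exists (dot x e0 / K e0), e0.
have [c c0 cK] := enorm_le_is_norm.
exists (enorm x / c) => _ [y /= y0 <-].
rewrite ler_pdivrMr ?is_norm_gt0//; apply: le_trans (le_dot_enorm _ _) _.
rewrite -mulrA ler_wpM2l ?enorm_ge0// -(ler_pM2l c0) mulrA divff ?gt_eqF//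
  mul1r.
exact: cK.
Qed.

Lemma dot_le_dual x y : dot x y <= dual_norm K x * K y.
Proof.
have [->|y0] := eqVneq y 0.
  by rewrite is_norm0 mulr0 -(scale0r 0) dotZr mul0r.
rewrite -ler_pdivrMr ?is_norm_gt0//; apply: ub_le_sup; last by exists y.
by case: (dual_has_sup x).
Qed.

Lemma dual_norm_le x (b : R) : (forall y, dot x y <= b * K y) ->
  dual_norm K x <= b.
Proof.
move=> h; apply: ge_sup; first by case: (dual_has_sup x).
by move=> _ [y y0 <-]; rewrite ler_pdivrMr ?is_norm_gt0.
Qed.

Lemma is_norm_dual_norm : is_norm (dual_norm K).
Proof.
have ge0 x : 0 <= dual_norm K x.
  have h1 := dot_le_dual x e0; have h2 := dot_le_dual x (- e0).
  rewrite dotNr is_normN in h2; rewrite -(pmulr_lge0 _ (is_norm_gt0 e0_neq0)).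
  lra.
have Zle (c : R) x : dual_norm K (c *: x) <= `|c| * dual_norm K x.
  apply: dual_norm_le => y; rewrite dotZl.
  have [c0|c0] := leP 0 c.
    by rewrite ger0_norm// -mulrA ler_wpM2l// dot_le_dual.
  rewrite ltr0_norm// -mulrNN -dotNr -mulrA -(is_normN y) ler_wpM2l
    ?dot_le_dual//.
  by rewrite oppr_ge0 ltW.
split => //.
- move=> x x0; apply: dot_eq0; apply/eqP; rewrite eq_le dot_self_ge0 andbT.
  by apply: le_trans (dot_le_dual x x) _; rewrite x0 mul0r.
- move=> c x; apply/eqP; rewrite eq_le Zle/=.
  have [->|c0] := eqVneq c 0; first by rewrite normr0 mul0r.
  rewrite -(@ler_pM2l _ `|c|^-1) ?invr_gt0 ?normr_gt0// mulrA mulVf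
    ?normr_eq0// mul1r.
  by rewrite -normfV; apply: le_trans (Zle _ _);
    rewrite scalerA mulVf// scale1r.
- move=> x y; apply: dual_norm_le => z; rewrite dotDl mulrDl lerD//;
  exact: dot_le_dual.
Qed.

(** This is the Lipschitz constant of K. Let u maximise K on the unit sphere. Perturbing u to u - t
    y and letting t tend to 0 gives K(u) (u . y) <= K(y) for all y. Thus K(u) u lies in the dual
    unit ball and has Euclidean norm K(u), so K(u) is at most the radius. *)
Lemma dual_ball_radius_ge x : K x <= dual_ball_radius K * enorm x.
Proof.
have [u u1 Ku] := is_norm_sphere_max.
apply: le_trans (Ku x) _; rewrite ler_wpM2r ?enorm_ge0//.
have Ku0 := K_ge0 u.
have sub y : K u * dot u y <= K y.
  apply/ler_addgt0Pr => eps eps0.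
  (* The second-order error is t^2 K(u) |y|^2 / 2, and t = eps / C makes it at most t eps. In [h3],
     the bound |v| <= (|v|^2 + 1) / 2 linearizes the square root at 1. *)
  pose C := K u * dot y y / 2 + 1.
  have C0 : 0 < C by rewrite ltr_wpDl// divr_ge0// mulr_ge0 ?dot_self_ge0.
  pose t := eps / C; have t0 : 0 < t by rewrite divr_gt0.
  have h1 : K u <= K (u - t *: y) + t * K y.
    have := KD (u - t *: y) (t *: y).
    by rewrite subrK KZ gtr0_norm.
  have h2 := Ku (u - t *: y).
  have h3 : enorm (u - t *: y) <= (enorm (u - t *: y) ^+ 2 + 1) / 2.
    have := sqr_ge0 (enorm (u - t *: y) - 1); lra.
  have h4 : enorm (u - t *: y) ^+ 2 = 1 - 2 * (t * dot u y) + t ^+ 2 * dot y y.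
    rewrite sqr_enorm !(dotBl, dotBr, dotZl,
      dotZr) -(sqr_enorm u) u1 (dotC y u); ring.
  have h5 := ler_wpM2l Ku0 h3; rewrite h4 in h5.
  rewrite -(ler_pM2l t0).
  have h6 : t * (K u * dot y y / 2) <= eps.
    have -> : eps = t * C by rewrite /t divfK// gt_eqF.
    by rewrite ler_pM2l// lerDl.
  have h7 := ler_wpM2l (ltW t0) h6.
  lra.
(* The supremum is finite: on the dual ball |v|^2 <= K(v) <= K(u) |v|. *)
apply: ub_le_sup.
  exists (K u) => _ [v /= v1 <-].
  have [->|v0] := eqVneq (enorm v) 0; first by [].
  have vp : 0 < enorm v by rewrite lt_def v0 enorm_ge0.
  rewrite -(ler_pM2r vp) -expr2 sqr_enorm; apply: le_trans (dot_le_dual v v) _.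
  by apply: le_trans (Ku v); rewrite ler_piMl.
exists (K u *: u); last by rewrite enormZ ger0_norm// u1 mulr1.
by apply: dual_norm_le => y; rewrite dotZl mul1r.
Qed.

Lemma dual_ball_radius_gt0 : 0 < dual_ball_radius K.
Proof.
have := lt_le_trans (is_norm_gt0 e0_neq0) (dual_ball_radius_ge e0).
by apply: contraTT; rewrite -!leNgt => /mulr_le0_ge0; apply; exact: enorm_ge0.
Qed.

Lemma is_norm_inv_le x : (K x)^-1 <= dual_norm K x / dot x x.
Proof.
have [->|x0] := eqVneq x 0.
  by rewrite is_norm0 invr0 dot0l invr0 mulr0.
have d0 : 0 < dot x x.
  rewrite lt_def dot_self_ge0 andbT; apply: contra_neq x0; exact: dot_eq0.
rewrite ler_pdivlMr// mulrC ler_pdivrMr ?is_norm_gt0//; exact: dot_le_dual.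
Qed.

Lemma argmin_on_ball_exists (c : 'rV[R]_n) (rho : R) : 0 <= rho ->
  argmin_on K [set nu | enorm (c - nu) ^+ 2 <= rho] !=set0.
Proof.
move=> rho0.
have S0 : [set nu : 'rV[R]_n | enorm (c - nu) ^+ 2 <= rho] !=set0.
  by exists c => /=; rewrite subrr sqr_enorm dot0l.
have [u /set_mem uS minu] := EVT_min_rV S0 (compact_enorm_ball (c :=
  c) (rho := rho))
  (continuous_subspaceT continuous_is_norm).
by exists u; split => // v vS; apply: minu; exact: mem_set.
Qed.

(* If [K theta > K mu], every point of the half-open segment from theta to mu
   has smaller [K], hence lies outside the ball;
     so the ball constraint is active
   and the angle at theta is obtuse. *)
Lemma argmin_on_ball_error (c mu theta : 'rV[R]_n) (rho : R) :
  argmin_on K [set nu | enorm (c - nu) ^+ 2 <= rho] theta ->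
  enorm (theta - mu) ^+ 2 <=
    `|rho - enorm (c - mu) ^+ 2| + 4 * K mu * dual_norm K (c - mu).
Proof.
move=> [/= thS min_th].
have dual0 : 0 <= dual_norm K (c - mu) by case: is_norm_dual_norm.
have [Kle|Klt] := leP (K theta) (K mu).
  have h1 := dot_le_dual (c - mu) (theta - mu).
  have h2 : K (theta - mu) <= 2 * K mu by have := is_normB theta mu; lra.
  have h3 := ler_wpM2l dual0 h2.
  have h4 : enorm (theta - mu) ^+ 2 =
    enorm (c - theta) ^+ 2 - enorm (c - mu) ^+ 2
      + 2 * dot (c - mu) (theta - mu).
    rewrite !sqr_enorm !(dotBl,
      dotBr) (dotC theta c) (dotC mu c) (dotC mu theta); ring.
  have h5 := ler_norm (rho - enorm (c - mu) ^+ 2).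
  lra.
have [p pE] : exists p, p = c - theta by exists (c - theta).
have [q qE] : exists q, q = mu - theta by exists (mu - theta).
have seg t : 0 < t -> t <= 1 ->
  rho < dot p p - 2 * t * dot p q + t ^+ 2 * dot q q.
  move=> t0 t1.
  have Kt : K (theta + t *: q) < K theta.
    have -> : theta + t *: q = (1 - t) *: theta + t *: mu.
      by rewrite qE scalerBr scalerBl scale1r addrCA addrC.
    apply: le_lt_trans (KD _ _) _;
      rewrite !KZ ger0_norm ?subr_ge0// gtr0_norm//.
    have := Klt; rewrite -(ltr_pM2l t0); lra.
  have : ~ (enorm (c - (theta + t *: q)) ^+ 2 <= rho).
    by move=> h; have := min_th _ h; rewrite leNgt Kt.
  move=> /negP; rewrite -ltNge => /lt_le_trans; apply.
  rewrite opprD addrA -pE sqr_enorm !(dotBl, dotBr, dotZl, dotZr) (dotC q p).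
  rewrite le_eqVlt; apply/orP; left; apply/eqP; ring.
have qq0 := dot_self_ge0 q.
have pp_le : dot p p <= rho by rewrite pE -sqr_enorm.
have pq0 : dot p q <= 0.
  rewrite leNgt; apply/negP => pq.
  (* This step is short enough that t^2 |q|^2 <= t (p . q): the point moved towards mu would stay in
     the ball, against [seg]. *)
  pose t := Num.min 1 (dot p q / (dot q q + 1)).
  have q1 : 0 < dot q q + 1 by rewrite ltr_wpDl.
  have t0 : 0 < t by rewrite lt_min ltr01 divr_gt0.
  have t1 : t <= 1 by rewrite ge_min lexx.
  have t2 : t * (dot q q + 1) <=
    dot p q by rewrite -ler_pdivlMr// ge_min lexx orbT.
  have h1 := seg t t0 t1.
  have h2 := ler_wpM2l (ltW t0) t2.
  have h3 : 0 < t * dot p q by rewrite mulr_gt0.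
  have h4 : 0 <= t ^+ 2 by rewrite sqr_ge0.
  lra.
have rho_le : rho <= dot p p.
  apply/ler_addgt0Pr => eps eps0.
  (* [D] bounds the growth rate of the squared distance along the segment, so t = eps / D (capped at
     1) yields rho < |p|^2 + eps. *)
  pose D := - 2 * dot p q + dot q q + 1.
  have D0 : 0 < D by rewrite /D; lra.
  pose t := Num.min 1 (eps / D).
  have t0 : 0 < t by rewrite lt_min ltr01 divr_gt0.
  have t1 : t <= 1 by rewrite ge_min lexx.
  have t2 : t * D <= eps by rewrite -ler_pdivlMr// ge_min lexx orbT.
  have h1 := seg t t0 t1.
  have h2 : t ^+ 2 * dot q q <= t * dot q q.
    by rewrite ler_wpM2r// expr2 ler_piMr// ltW.
  move: t2; rewrite /D => t2; lra.
have h4 : enorm (theta - mu) ^+ 2 = enorm (c - mu) ^+ 2 - dot p p + 2 * dot p q.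
  rewrite !sqr_enorm pE qE !(dotBl,
    dotBr) (dotC theta c) (dotC mu c) (dotC mu theta); ring.
have h5 := ler_norm (- (rho - enorm (c - mu) ^+ 2)); rewrite normrN in h5.
have h6 : 0 <= 4 * K mu * dual_norm K (c - mu) by rewrite !mulr_ge0.
lra.
Qed.

End norms.

(** * The risk bound *)

Section mean_bounds.
Context (R : realType).

(** Bundled so that a majorant, its measurability and the bound on its mean are assembled together,
    summand by summand. *)
Definition mean_le d (T : measurableType d) (m : {measure set T -> \bar R})
    (X : T -> R) (r : R) : Prop :=
  [/\ measurable_fun setT X, forall w, 0 <= X w & (\int[m]_w (X w)%:E <=
    r%:E)%E].

Lemma mean_le_addZ d (T : measurableType d) (m : {measure set T -> \bar R})
    (X f : T -> R) (r q c : R) : 0 <= c ->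
  mean_le m X r -> mean_le m f q ->
    mean_le m (fun w => X w + c * f w) (r + c * q).
Proof.
move=> c0 [mX X0 Xr] [mf f0 fq]; split.
- by apply: measurable_funD => //; exact: measurable_funM.
- by move=> w; rewrite addr_ge0// mulr_ge0.
under eq_integral do rewrite EFinD EFinM.
rewrite ge0_integralDZ//; [|exact/measurable_EFinP|exact/measurable_EFinP].
by rewrite EFinD EFinM leeD// lee_wpmul2l.
Qed.

Lemma mean_le_cst d (T : measurableType d) (P : probability T R) (c : R) :
  0 <= c -> mean_le P (cst c) c.
Proof.
move=> c0; split => //; rewrite -[leLHS]/(\int[P]_w c%:E)%E integral_cst// [X
  in (_ * X)%E](@probability_setT _ _ _ P).
by rewrite mule1.
Qed.

Lemma mean_le_standardize d (T : measurableType d) (P : probability T R) n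
    (X : T -> 'rV[R]_n) (mu : 'rV[R]_n) (s : R) (f : borel R n -> R) (q : R) :
  0 < s -> has_gaussian_law P X mu (s ^+ 2)%:M ->
  mean_le (gauss R n) f q -> mean_le P (fun w => f (standardize X mu s w)) q.
Proof.
move=> s0 lawX [mf f0 fq]; split => //.
  apply: (measurableT_comp mf).
  exact: (measurable_standardize lawX).
by rewrite (ge0_integral_standardize s0 lawX (f := EFin \o f))//;
  exact/measurable_EFinP.
Qed.

Lemma mean_le_mono d (T : measurableType d) (m : {measure set T -> \bar R})
    (X f : T -> R) (r : R) : measurable_fun setT f -> (forall w, 0 <= f w) ->
  (forall w, f w <= X w) -> mean_le m X r -> mean_le m f r.
Proof.
move=> mf f0 fX [mX X0 Xr]; split => //; apply: le_trans Xr.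
by apply: ge0_le_integral_nonmeasurable => w; rewrite lee_fin.
Qed.

End mean_bounds.

Section gaussian_norm_moments.
Context (R : realType) (n : nat) (K : 'rV[R]_n -> R).
Hypotheses (KN : is_norm K) (n0 : (0 < n)%N).

Let mK : measurable_fun setT (K : borel R n -> R).
Proof. exact: measurable_is_norm. Qed.
Let K_ge0 x : 0 <= K x. Proof. by case: KN. Qed.

Lemma gauss_normsq_mean : mean_le (gauss R n) (fun x => dot (x : 'rV_n) x) n%:R.
Proof.
split; [exact: measurable_dot_self|exact: dot_self_ge0|by rewrite gauss_normsq].
Qed.

Lemma gauss_norm4_mean :
  mean_le (gauss R n) (fun x => dot (x : 'rV_n) x ^+ 2) ((n.+2)%:R * n%:R).
Proof.
split; last exact: gauss_norm4_le.
  by apply: measurable_funX; exact: measurable_dot_self.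
by move=> x; rewrite sqr_ge0.
Qed.

Let moment_fin (f : borel R n -> R) (r : R) : mean_le (gauss R n) f r ->
  exists2 e : R, 0 <= e & (\int[gauss R n]_x (f x)%:E = e%:E)%E.
Proof.
case=> mf f0 fr; have : (0 <= \int[gauss R n]_x (f x)%:E)%E.
  by apply: integral_ge0 => x _; rewrite lee_fin.
by move: fr; case: (\int[gauss R n]_x (f x)%:E)%E => [e||]// _ e0; exists e.
Qed.

Lemma gauss_norm_mean1 :
  exists2 e : R, 0 <= e & (\int[gauss R n]_x (K x)%:E = e%:E)%E.
Proof.
have [C C0 KC] := is_norm_le_enorm KN.
have C2 : 0 <= C / 2 by rewrite divr_ge0.
apply: (moment_fin (r := C / 2 + C / 2 * n%:R)); apply: mean_le_mono mK K_ge0 _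
  (mean_le_addZ C2 (mean_le_cst (gauss R n) C2) gauss_normsq_mean) => x.
apply: le_trans (KC x) _; rewrite -sqr_enorm.
have : 0 <= C / 2 * (enorm (x : 'rV_n) - 1) ^+ 2 by rewrite mulr_ge0 ?sqr_ge0.
rewrite /cst/=; lra.
Qed.

(** Comparison with the Euclidean norm from above gives finiteness, from below strict positivity,
    which is wanted because the AM-GM weights divide by this moment. *)
Lemma gauss_norm_mean2 :
  exists2 e : R, 0 < e & (\int[gauss R n]_x (K x ^+ 2)%:E = e%:E)%E.
Proof.
have [C C0 KC] := is_norm_le_enorm KN.
have [c c0 cK] := enorm_le_is_norm KN n0.
have mK2 : measurable_fun setT (fun x : borel R n => K x ^+ 2) by exact:
  measurable_funX.
have K20 x : 0 <= K x ^+ 2 by rewrite sqr_ge0.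
have C2 : 0 <= C ^+ 2 by rewrite sqr_ge0.
have [e e0 eE] : exists2 e : R, 0 <= e & (\int[gauss R n]_x (K x ^+ 2)%:E =
  e%:E)%E.
  apply: (moment_fin (r := 0 + C ^+ 2 * n%:R)); apply: mean_le_mono mK2 K20 _
    (mean_le_addZ C2 (mean_le_cst (gauss R n) (lexx 0)) gauss_normsq_mean) => x.
  rewrite add0r -sqr_enorm -exprMn; apply: lerXn2r; rewrite ?nnegrE ?K_ge0//.
  by rewrite mulr_ge0 ?enorm_ge0.
exists e => //; suff : c ^+ 2 * n%:R <= e.
  by apply: lt_le_trans; rewrite mulr_gt0 ?exprn_gt0// ltr0n.
rewrite -lee_fin -eE EFinM -gauss_normsq -ge0_integralZl//; last 3 first.
- by apply/measurable_EFinP; exact: measurable_dot_self.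
- by move=> x _; rewrite lee_fin dot_self_ge0.
- by rewrite lee_fin sqr_ge0.
apply: ge0_le_integral_nonmeasurable => x.
  by rewrite -EFinM lee_fin mulr_ge0 ?sqr_ge0 ?dot_self_ge0.
rewrite -EFinM lee_fin -sqr_enorm -exprMn; apply: lerXn2r;
  rewrite ?nnegrE ?K_ge0//.
by rewrite mulr_ge0 ?enorm_ge0// ltW.
Qed.

(** Finiteness is by comparison with |x|^4. Positivity follows from the second moment [e2]:
    integrating 2 e2 K^2 <= e2^2 + K^4 gives e >= e2^2. *)
Lemma gauss_norm_mean4 :
  exists2 e : R, 0 < e & (\int[gauss R n]_x (K x ^+ 4)%:E = e%:E)%E.
Proof.
have [C C0 KC] := is_norm_le_enorm KN.
have mK4 : measurable_fun setT (fun x : borel R n => K x ^+ 4) by exact: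
  measurable_funX.
have mK2 : measurable_fun setT (fun x : borel R n => K x ^+ 2) by exact:
  measurable_funX.
have K40 x : 0 <= K x ^+ 4 by rewrite exprn_ge0.
have K20 x : 0 <= K x ^+ 2 by rewrite exprn_ge0.
have C4 : 0 <= C ^+ 4 by rewrite exprn_ge0.
have [e e0 eE] : exists2 e : R, 0 <= e & (\int[gauss R n]_x (K x ^+ 4)%:E =
  e%:E)%E.
  apply: (moment_fin (r := 0 + C ^+ 4 * ((n.+2)%:R * n%:R)));
    apply: mean_le_mono mK4 K40 _
    (mean_le_addZ C4 (mean_le_cst (gauss R n) (lexx 0)) gauss_norm4_mean) => x.
  rewrite add0r -sqr_enorm -exprM -exprMn; apply: lerXn2r;
    rewrite ?nnegrE ?K_ge0//.
  by rewrite mulr_ge0 ?enorm_ge0.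
exists e => //; have [e2 e20 e2E] := gauss_norm_mean2.
have H4 : mean_le (gauss R n) (fun x => K x ^+ 4) e by split => //; rewrite eE.
have := mean_le_addZ ler01 (mean_le_cst (gauss R n) (sqr_ge0 e2)) H4.
case=> _ _ h; have : (2 * e2 * e2 <= e2 ^+ 2 + 1 * e).
  rewrite -lee_fin; apply: le_trans h.
  have t0 : 0 <= 2 * e2 by rewrite mulr_ge0// ltW.
  rewrite EFinM -e2E -ge0_integralZl//; last 2 first.
  - exact/measurable_EFinP.
  - by move=> x _; rewrite lee_fin.
  apply: ge0_le_integral_nonmeasurable => x.
    by rewrite -EFinM lee_fin mulr_ge0.
  rewrite -EFinM lee_fin /cst/=.
  have := sqr_ge0 (e2 - K x ^+ 2); lra.
by have : 0 < e2 ^+ 2 := exprn_gt0 2 e20; lra.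
Qed.

(** Duality bounds the integrand by h / |x|^(2k), with h the k-th power of the dual norm,
    homogeneous of degree k; k = 2 and k = 4 produce the denominators n - 2 and n - 4. *)
Lemma gauss_inverse_norm_mean (k : nat) (e : R) : (0 < k < n)%N ->
  (\int[gauss R n]_x (dual_norm K x ^+ k)%:E = e%:E)%E ->
  mean_le (gauss R n) (fun x => (K x)^-1 ^+ k) (e / (n%:R - k%:R) ^+ k).
Proof.
move=> /andP[k0 kn] eE.
have DN := is_norm_dual_norm KN n0.
have D_ge0 x : 0 <= dual_norm K x by case: DN.
have mV : measurable_fun setT (fun x : borel R n => (K x)^-1 ^+ k).
  by apply: measurable_funX; exact: (measurableT_comp (@measurable_invr R) mK).
split => //.
  by move=> x; rewrite exprn_ge0// invr_ge0.
have mD : measurable_fun setT (fun x : borel R n => dual_norm K x ^+ k).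
  by apply: measurable_funX; exact: (measurable_is_norm DN).
have D0 (x : borel R n) : 0 <= dual_norm K x ^+ k by rewrite exprn_ge0.
have DZ (r : R) (x : borel R n) : 0 < r ->
    dual_norm K (r *: (x : 'rV_n)) ^+ k = r ^+ k * dual_norm K x ^+ k.
  by move=> r0; case: DN => _ _ + _ => ->; rewrite gtr0_norm// exprMn.
have D00 : dual_norm K 0 ^+ k = 0 by rewrite (is_norm0 DN) expr0n eqn0Ngt k0.
apply: le_trans (gauss_inverse_moment mD D0 DZ eE kn D00).
apply: ge0_le_integral_nonmeasurable => x; rewrite lee_fin.
  by rewrite exprn_ge0// invr_ge0.
rewrite -expr_div_n; apply: lerXn2r;
  rewrite ?nnegrE ?invr_ge0 ?divr_ge0 ?dot_self_ge0//.
exact: is_norm_inv_le.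
Qed.

Lemma gauss_norm_concentration : exists M : R,
  mean_le (gauss R n) (fun x => (K x - M) ^+ 4) (128 * dual_ball_radius K ^+ 4).
Proof.
have a0 := dual_ball_radius_gt0 KN n0.
have [|M HM] := gauss_lipschitz_moment4 a0 mK.
  move=> x y; apply: le_trans (is_norm_distr KN _ _) _.
  exact: dual_ball_radius_ge.
exists M; split => //.
  by apply: measurable_funX; exact: measurable_funB.
by move=> x; rewrite (exprM _ 2 2) sqr_ge0.
Qed.

End gaussian_norm_moments.

(** * Pointwise error bound *)

Section pointwise.
Context (R : realType).

(** Using (d1 + d2)^2 <= 2 d1^2 + 2 d2^2, the bias due to Kt(mu) and the fluctuation of Kt are
    decoupled. *)
Lemma sqr_sub1_le (x d1 d2 : R) : 0 <= d1 -> 0 <= d2 -> `|x - 1| <= d1 + d2 ->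
  `|x ^+ 2 - 1| <= 2 * d1 ^+ 2 + 2 * d1 + (2 * d2 ^+ 2 + 2 * d2).
Proof.
move=> d10 d20 h; rewrite (_ : x ^+ 2 - 1 = (x - 1) * (x - 1 + 2));
  last by ring.
rewrite normrM.
have h2 : `|x - 1 + 2| <= d1 + d2 + 2.
  by apply: le_trans (ler_normD _ _) _;
    rewrite (ger0_norm (_ : 0 <= 2))// lerD2r.
have := ler_pM (normr_ge0 _) (normr_ge0 _) h h2.
have := sqr_ge0 (d1 - d2); lra.
Qed.

Lemma amgm2 (x c : R) : 0 < c -> 2 * x <= c^-1 * x ^+ 2 + c.
Proof.
move=> c0; rewrite -subr_ge0 (_ : _ - _ = c^-1 * (x - c) ^+ 2).
  by rewrite mulr_ge0 ?sqr_ge0// invr_ge0 ltW.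
by field; rewrite gt_eqF.
Qed.

(** A pointwise form of Cauchy-Schwarz: centring at [M] separates [kw] from [kz], and the weight
    [eta] separates each of them from [V]. *)
Lemma ratio_error_sqr_le (kw kz M V eta : R) : 0 < eta ->
  (`|kw - kz| * V) ^+ 2 <=
  eta * (kw - M) ^+ 4 + eta * (kz - M) ^+ 4 + 2 / eta * V ^+ 4.
Proof.
move=> eta0; rewrite exprMn real_normK ?num_real//.
have h x : 2 * (x ^+ 2 * V ^+ 2) <= eta * x ^+ 4 + eta^-1 * V ^+ 4.
  rewrite -subr_ge0 (_ : _ - _ = eta^-1 * (eta * x ^+ 2 - V ^+ 2) ^+ 2).
    by rewrite mulr_ge0 ?sqr_ge0// invr_ge0 ltW.
  by field; rewrite gt_eqF.
have h1 := h (kw - M); have h2 := h (kz - M).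
have h3 : 0 <= (kw - M + (kz - M)) ^+ 2 * V ^+ 2 by rewrite mulr_ge0 ?sqr_ge0.
lra.
Qed.

Context (n : nat) (K Kt : 'rV[R]_n -> R) (mu : 'rV[R]_n) (s : R).
Hypotheses (n0 : (0 < n)%N) (KN : is_norm K) (KtN : is_norm Kt) (s0 : 0 < s).

Lemma mu_hat_error (y z w : 'rV[R]_n) (V d1 d2 : R) :
  w = s^-1 *: (y - mu) -> V = (Kt z)^-1 ->
  d1 = Kt mu / s * V -> d2 = `|Kt w - Kt z| * V ->
  enorm (mu_hat K Kt y z - mu) ^+ 2 <=
  n%:R * s ^+ 2 * (4 * K mu / (n%:R * s) * dual_norm K w
    + n%:R^-1 * `|dot w w - n%:R|
    + (2 * d1 ^+ 2 + 2 * d1 + (2 * d2 ^+ 2 + 2 * d2))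
    + \1_[set 0 : 'rV_n] z).
Proof.
move=> wE VE d1E d2E.
have Kt_ge0 x : 0 <= Kt x by case: KtN.
have nR : 0 < n%:R :> R by rewrite ltr0n.
have rho0 : 0 <= n%:R * sigma_hat Kt y z ^+ 2 by rewrite mulr_ge0 ?sqr_ge0.
have ns0 : 0 <= n%:R * s ^+ 2 by apply: mulr_ge0 => //; exact: sqr_ge0.
have th := @getPex _ _ (argmin_on_ball_exists KN y rho0).
apply: le_trans (argmin_on_ball_error KN n0 mu th) _.
have yE : y - mu = s *: w by rewrite wE scalerA divff ?gt_eqF// scale1r.
have -> : dual_norm K (y - mu) = s * dual_norm K w.
  by rewrite yE; case: (is_norm_dual_norm KN n0) => _ _ -> _; rewrite gtr0_norm.
have -> : enorm (y - mu) ^+ 2 = s ^+ 2 * dot w w.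
  by rewrite yE enormZ exprMn sqr_enorm real_normK ?num_real.
have ratio : `|(sigma_hat Kt y z / s) ^+ 2 - 1| <=
    2 * d1 ^+ 2 + 2 * d1 + (2 * d2 ^+ 2 + 2 * d2) + \1_[set 0 : 'rV_n] z.
  have V0 : 0 <= V by rewrite VE invr_ge0.
  have d10 : 0 <= d1 by rewrite d1E !mulr_ge0// invr_ge0 ltW.
  have d20 : 0 <= d2 by rewrite d2E mulr_ge0.
  (* At z = 0 the quotient [sigma_hat] is 0, so the error is exactly 1 and the indicator, of mean 0,
     pays for it. *)
  rewrite indicE; have [z0|z0] := eqVneq z 0.
    rewrite mem_set//= /sigma_hat z0 (is_norm0 KtN) invr0 mulr0 mul0r expr0n/=.
    rewrite sub0r normrN normr1 lerDr.
    by rewrite !addr_ge0// mulr_ge0// sqr_ge0.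
  rewrite memNset/=; last exact/eqP.
  rewrite addr0; apply: sqr_sub1_le => //.
  have kz := is_norm_gt0 KtN z0.
  have -> : sigma_hat Kt y z / s - 1 = (Kt y / s - Kt z) * V.
    by rewrite /sigma_hat VE; field; rewrite !gt_eqF.
  rewrite normrM (ger0_norm V0) d1E d2E -mulrDl ler_wpM2r//.
  have sw : Kt w = Kt (y - mu) / s.
    by rewrite wE; case: KtN => _ _ -> _; rewrite gtr0_norm ?invr_gt0// mulrC.
  have kyw : `|Kt y / s - Kt w| <= Kt mu / s.
    rewrite sw -mulrBl normrM [X in _ * X]gtr0_norm ?invr_gt0// ler_pM2r
      ?invr_gt0//.
    have h1 := is_norm_distr KtN y (y - mu).
    have h2 := is_norm_distr KtN (y - mu) y.
    rewrite opprB addrCA subrr addr0 in h1.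
    rewrite addrAC subrr sub0r (is_normN KtN) in h2.
    by rewrite ler_norml; apply/andP; split; lra.
  rewrite (_ : Kt y / s - Kt z = (Kt y / s - Kt w) + (Kt w - Kt z));
    last by ring.
  by apply: le_trans (ler_normD _ _) _; rewrite lerD2r.
have split_abs : `|n%:R * sigma_hat Kt y z ^+ 2 - s ^+ 2 * dot w w| <=
    n%:R * s ^+ 2 * (`|(sigma_hat Kt y z / s) ^+ 2 - 1| + n%:R^-1 * `|dot w w
      - n%:R|).
  have -> : n%:R * sigma_hat Kt y z ^+ 2 - s ^+ 2 * dot w w =
     n%:R * s ^+ 2 * (((sigma_hat Kt y z / s) ^+ 2 - 1) - n%:R^-1 * (dot w w -
       n%:R)).
    by field; rewrite !gt_eqF.
  rewrite normrM gtr0_norm; last by rewrite mulr_gt0// exprn_gt0.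
  rewrite ler_wpM2l//; apply: le_trans (ler_normB _ _) _.
  by rewrite lerD2l normrM gtr0_norm ?invr_gt0.
have -> : 4 * K mu * (s * dual_norm K w) =
    n%:R * s ^+ 2 * (4 * K mu / (n%:R * s) * dual_norm K w).
  by field; rewrite !gt_eqF.
apply: le_trans (lerD split_abs (lexx _)) _.
rewrite -mulrDr ler_wpM2l//.
by have := ratio; lra.
Qed.

End pointwise.

Lemma powR_invnK (R : realType) (x : R) (k : nat) : 0 <= x -> (0 < k)%N ->
  (x `^ k%:R^-1) ^+ k = x.
Proof.
move=> x0 k0; rewrite -powR_mulrn ?powR_ge0// -powRrM mulVf ?pnatr_eq0 -?lt0n//.
exact: powRr1.
Qed.

Theorem theorem1p3 (R : realType) (n : nat) (K Kt : 'rV[R]_n -> R)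
    (d : measure_display) (T : measurableType d) (P : probability T R)
    (Y Z : T -> 'rV[R]_n) (mu : 'rV[R]_n) (sigma : R) :
  (5 <= n)%N ->
  is_norm K -> is_norm Kt ->
  0 < sigma ->
  has_gaussian_law P Y mu (sigma ^+ 2)%:M ->
  has_gaussian_law P Z 0 1%:M ->
  let m := dual_moment P Kt Z in
  let a := dual_ball_radius Kt in
  ('E_P[fun w => (enorm (mu_hat K Kt (Y w) (Z w) - mu) ^+ 2)%R]
     * ((n%:R * sigma ^+ 2)^-1)%R%:E
   <= (16 / (n%:R * sigma) * K mu)%R%:E * 'E_P[fun w => dual_norm K (Z w)]
      + (2 * Num.sqrt (2 / n%:R))%R%:E
      + (2 * Kt mu ^+ 2 / ((n%:R - 2) ^+ 2 * sigma ^+ 2))%R%:E * m 2%N ^+ 2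
      + (64 * Num.sqrt 2 * a ^+ 2 / (n%:R - 4) ^+ 2)%R%:E * m 4%N ^+ 2
      + (4 * Kt mu / ((n%:R - 2) * sigma))%R%:E * m 2%N
      + (28 * a / (n%:R - 4))%R%:E * m 4%N)%E.
Proof.
move=> n5 KN KtN s0 lawY lawZ1; cbv zeta.
set m := dual_moment P Kt Z; set a := dual_ball_radius Kt.
have n0 : (0 < n)%N by exact: leq_trans n5.
have nR0 : 0 < n%:R :> R by rewrite ltr0n.
have n2 : 0 < n%:R - 2 :> R by rewrite subr_gt0 (ltr_nat R 2) (leq_trans _ n5).
have n4 : 0 < n%:R - 4 :> R by rewrite subr_gt0 (ltr_nat R 4).
have lawZ : has_gaussian_law P Z 0 (1 ^+ 2)%:M by rewrite expr1n.
have ZE w : standardize Z 0 1 w =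
  Z w by rewrite /standardize subr0 invr1 scale1r.
have DN := is_norm_dual_norm KN n0; have DtN := is_norm_dual_norm KtN n0.
have D_ge0 x : 0 <= dual_norm K x by case: DN.
have Dt_ge0 x : 0 <= dual_norm Kt x by case: DtN.
have K_ge0 x : 0 <= K x by case: KN.
have Kt_ge0 x : 0 <= Kt x by case: KtN.
have mD := measurable_is_norm DN; have mDt := measurable_is_norm DtN.
have [k1 k10 k1E] := gauss_norm_mean1 DN.
have [e2 e20 e2E] := gauss_norm_mean2 DtN n0.
have [e4 e40 e4E] := gauss_norm_mean4 DtN n0.
have [M concM] := gauss_norm_concentration KtN n0.
have a0 : 0 < a := dual_ball_radius_gt0 KtN n0.
have EZ (f : borel R n -> R) : measurable_fun setT f -> (forall x, 0 <= f x) ->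
    ('E_P[fun w => f (Z w)] = \int[gauss R n]_x (f x)%:E)%E.
  move=> mf f0; rewrite unlock -(ge0_integral_standardize ltr01 lawZ (f :=
    EFin \o f)).
  - by apply: eq_integral => w _; rewrite ZE.
  - exact/measurable_EFinP.
  - by move=> x; rewrite lee_fin.
pose m2 := e2 `^ 2%:R^-1; pose m4 := e4 `^ 4%:R^-1.
have m2E : m 2%N = m2%:E.
  rewrite /m /dual_moment (EZ (fun x => dual_norm Kt x ^+ 2)) ?e2E//.
  - exact: measurable_funX.
  - by move=> x; rewrite exprn_ge0.
have m4E : m 4%N = m4%:E.
  rewrite /m /dual_moment (EZ (fun x => dual_norm Kt x ^+ 4)) ?e4E//.
  - exact: measurable_funX.
  - by move=> x; rewrite exprn_ge0.
have m20 : 0 < m2 by exact: powR_gt0.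
have m40 : 0 < m4 by exact: powR_gt0.
have m2X : m2 ^+ 2 = e2 by apply: powR_invnK => //; exact: ltW.
have m4X : m4 ^+ 4 = e4 by apply: powR_invnK => //; exact: ltW.
rewrite m2E m4E (EZ (dual_norm K))// k1E.
(* Bounds for the L^2 and L^4 norms of 1 / Kt(Z). *)
pose v2 := m2 / (n%:R - 2); pose v4 := m4 / (n%:R - 4).
have v20 : 0 < v2 by rewrite divr_gt0.
have v40 : 0 < v4 by rewrite divr_gt0.
pose kap := Kt mu / sigma; have kap0 : 0 <= kap by rewrite divr_ge0// ltW.
pose q : R := Num.sqrt 2; have q2 : q ^+ 2 = 2 by rewrite sqr_sqrtr.
have q0 : 0 < q by rewrite sqrtr_gt0.
(* Weight for 2 d2 <= d2^2 / c + c, where d2^2 has mean at most 32 sqrt(2) a^2 v4^2; 7 rounds the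
   optimal factor sqrt(32 sqrt(2)). *)
pose c := 7 * a * v4; have c0 : 0 < c by rewrite mulr_gt0// mulr_gt0.
(* The minimiser of 256 a^4 eta + 2 v4^4 / eta; the minimum is 32 sqrt(2) a^2 v4^2. *)
pose eta := v4 ^+ 2 / (8 * q * a ^+ 2).
have eta0 : 0 < eta.
  by apply: divr_gt0; [exact: exprn_gt0|apply: mulr_gt0;
    [exact: mulr_gt0|exact: exprn_gt0]].
(* The weight for | |W|^2 - n |, equal to the square root of the variance bound. *)
pose lam : R := Num.sqrt (2 * n%:R).
have lam0 : 0 < lam by rewrite sqrtr_gt0 mulr_gt0.
have lam2 : lam ^+ 2 = 2 * n%:R by rewrite sqr_sqrtr// mulr_ge0.
pose W := standardize Y mu sigma; pose Z' := standardize Z 0 1.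
have meanD : mean_le (gauss R n) (dual_norm K) k1 by split => //; rewrite k1E.
have meanU : mean_le (gauss R n) (fun x => (dot (x : 'rV_n) x - n%:R) ^+ 2) (2
  * n%:R).
  split; last exact: gauss_normsq_variance.
    by apply: measurable_funX; apply: measurable_funB => //;
      exact: measurable_dot_self.
  by move=> x; rewrite sqr_ge0.
have meanV2 : mean_le (gauss R n) (fun x => (Kt x)^-1 ^+ 2) (v2 ^+ 2).
  rewrite /v2 exprMn exprVn m2X.
  by apply: gauss_inverse_norm_mean => //; rewrite (leq_trans _ n5).
have meanV4 : mean_le (gauss R n) (fun x => (Kt x)^-1 ^+ 4) (v4 ^+ 4).
  by rewrite /v4 exprMn exprVn m4X; apply: gauss_inverse_norm_mean.
have mean0 : mean_le (gauss R n) (\1_[set 0 : 'rV_n]) 0.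
  split => //; last by rewrite gauss_zero// (leq_trans _ n5).
  apply: measurable_indic.
  rewrite (_ : [set _] = (fun x : borel R n => dot (x : 'rV_n) x) @^-1` [set
    0]).
    by rewrite -[X in measurable X]setTI; apply: measurable_dot_self.
  by apply/seteqP; split => x /= => [->|/dot_eq0//]; rewrite dot0l.
(* Coefficients of the majorant: [c1] for the dual norm of W, [c2] for (|W|^2 - n)^2, [c3] for
   Kt(Z)^-2, [c4] for each fourth central moment, [c6] for Kt(Z)^-4; [c7] sums the constants left by
   the AM-GM splits. *)
pose c1 := 4 * K mu / (n%:R * sigma).
pose c2 := n%:R^-1 / 2 * lam^-1.
pose c3 := 2 * kap ^+ 2 + kap / v2.
pose c4 := (2 + c^-1) * eta.
pose c6 := (2 + c^-1) * (2 / eta).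
pose c7 := n%:R^-1 / 2 * lam + kap * v2 + c.
have c10 : 0 <= c1 by rewrite divr_ge0// mulr_ge0// ltW.
have c20 : 0 <= c2 by rewrite !mulr_ge0// invr_ge0 ltW.
have c30 : 0 <= c3 by rewrite addr_ge0// ?mulr_ge0 ?sqr_ge0// invr_ge0 ltW.
have cV0 : 0 <= 2 + c^-1 by rewrite addr_ge0// invr_ge0 ltW.
have c40 : 0 <= c4 by rewrite mulr_ge0// ltW.
have c60 : 0 <= c6 by rewrite mulr_ge0// divr_ge0// ltW.
have c70 : 0 <= c7.
  by apply: addr_ge0; [apply: addr_ge0|]; rewrite ?mulr_ge0// ?invr_ge0 ltW.
have onW f r (H : mean_le (gauss R n) f r) := mean_le_standardize s0 lawY H.
have onZ f r (H : mean_le (gauss R n) f r) := mean_le_standardize ltr01 lawZ H.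
have ns0 : 0 < n%:R * sigma ^+ 2 by rewrite mulr_gt0// exprn_gt0.
(* The nesting defines the majorant [X] and the bound [r] at once; each summand depends on W alone
   or on Z alone, so only the marginal laws are used. *)
have := mean_le_addZ (ltW ns0) (mean_le_cst P (lexx 0))
  (mean_le_addZ ler01 (mean_le_addZ c60 (mean_le_addZ c40 (mean_le_addZ c40
    (mean_le_addZ c30 (mean_le_addZ c20 (mean_le_addZ c10 (mean_le_cst P c70)
      (onW _ _ meanD)) (onW _ _ meanU)) (onZ _ _ meanV2)) (onW _ _ concM))
      (onZ _ _ concM)) (onZ _ _ meanV4)) (onZ _ _ mean0)).
set X := (fun w => cst 0 w + _); set r := (X in 0 + _ * X).
case=> _ _ meanX.
have pw w : enorm (mu_hat K Kt (Y w) (Z w) - mu) ^+ 2 <= X w.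
  rewrite /X /cst/= add0r mul1r; set z := standardize Z 0 1 w;
    set y := standardize Y mu sigma w.
  have zE : z = Z w by exact: ZE.
  apply: le_trans (mu_hat_error n0 KN KtN s0 (z :=
    Z w) (erefl y) erefl erefl erefl) _.
  rewrite ler_pM2l// zE lerD2r.
  set V := (Kt (Z w))^-1; set d2 := `|_| * V.
  have h1 := amgm2 `|dot (y : 'rV_n) y - n%:R| lam0.
  rewrite real_normK ?num_real// in h1.
  have ni0 : 0 <= n%:R^-1 / 2 :> R by rewrite divr_ge0// invr_ge0 ltW.
  have h1' := ler_wpM2l ni0 h1.
  have h2 := ler_wpM2l kap0 (amgm2 V v20).
  have h3 := amgm2 d2 c0.
  have h4 := ler_wpM2l cV0 (ratio_error_sqr_le (Kt y) (Kt (Z w)) M V eta0).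
  rewrite -/d2 in h4.
  rewrite /c1 /c2 /c3 /c4 /c6 /c7 -/kap exprMn; lra.
have leE : ('E_P[fun w => (enorm (mu_hat K Kt (Y w) (Z w) - mu) ^+ 2)%R] <=
    (n%:R * sigma ^+ 2 * r)%:E)%E.
  rewrite unlock; rewrite add0r in meanX; apply: le_trans meanX.
  apply: ge0_le_integral_nonmeasurable => w; rewrite lee_fin ?sqr_ge0//.
apply: (@le_trans _ _ r%:E).
  have nsi0 : (0 <= ((n%:R * sigma ^+ 2)^-1)%:E)%E by rewrite lee_fin invr_ge0
    ltW.
  apply: le_trans (lee_wpmul2r nsi0 leE) _.
  by rewrite -EFinM lee_fin mulrAC divff ?gt_eqF// mul1r.
rewrite -!EFin_expe -!EFinM -!EFinD lee_fin /r mulr0 addr0.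
have sq2n : Num.sqrt (2 / n%:R) = lam / n%:R.
  rewrite -[RHS]ger0_norm ?divr_ge0 ?ltW// -sqrtr_sqr; congr Num.sqrt.
  by rewrite exprMn exprVn lam2; field; rewrite gt_eqF.
(* The terms quadratic in [kap * v2] and [a * v4] come out exactly as stated; the others with
   smaller constants: 4 for 16, 1 for 2, 2 for 4, and less than 14 for 28. *)
have t1 : c1 * k1 <= 16 / (n%:R * sigma) * K mu * k1.
  rewrite ler_wpM2r// /c1 (_ : 16 / _ * _ = 4 * (4 * K mu / (n%:R * sigma)));
    last by ring.
  by rewrite ler_peMl// ler1n.
have t2 : n%:R^-1 / 2 * lam + c2 * (2 * n%:R) = lam / n%:R.
  by rewrite /c2 -lam2; field; rewrite !gt_eqF.
have t3 : kap * v2 + c3 * v2 ^+ 2 = 2 * kap ^+ 2 * v2 ^+ 2 + 2 * kap * v2.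
  by rewrite /c3; field; rewrite gt_eqF.
have t4 : c4 * (128 * a ^+ 4) + c4 * (128 * a ^+ 4) + c6 * v4 ^+ 4 =
    64 * q * a ^+ 2 * v4 ^+ 2 + 32 / 7 * q * (a * v4).
  have e1 : eta * (128 * a ^+ 4) + eta * (128 * a ^+ 4) + 2 / eta * v4 ^+ 4 =
      32 * q * a ^+ 2 * v4 ^+ 2.
    rewrite (_ : eta * _ + eta * _ = 16 * q ^+ 2 * a ^+ 2 * v4 ^+ 2 / q);
      last first.
      by rewrite q2 /eta; field; rewrite !gt_eqF.
    by rewrite /eta; field; rewrite !gt_eqF.
  transitivity ((2 + c^-1) * (eta * (128 * a ^+ 4) + eta * (128 * a ^+ 4) + 2
    / eta * v4 ^+ 4)).
    by rewrite /c4 /c6; ring.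
  by rewrite e1 /c; field; rewrite !gt_eqF.
(* This rational bound suffices, as (32 / 7) (3 / 2) + 7 < 14. *)
have q32 : q <= 3 / 2.
  by rewrite -(@ler_pXn2r _ 2)// ?nnegrE ?ltW// q2; lra.
have av0 : 0 < a * v4 by rewrite mulr_gt0.
have t5 : 32 / 7 * q * (a * v4) + c <= 28 * (a * v4).
  have := ler_wpM2r (ltW av0) q32; rewrite /c; lra.
rewrite sq2n -/q.
have u1 : 2 * Kt mu ^+ 2 / ((n%:R - 2) ^+ 2 * sigma ^+ 2) * m2 ^+ 2 =
  2 * kap ^+ 2 * v2 ^+ 2.
  by rewrite /kap /v2; field; rewrite !gt_eqF.
have u2 : 64 * q * a ^+ 2 / (n%:R - 4) ^+ 2 * m4 ^+ 2 =
  64 * q * a ^+ 2 * v4 ^+ 2.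
  by rewrite /v4; field; rewrite gt_eqF.
have u3 : 4 * Kt mu / ((n%:R - 2) * sigma) * m2 = 4 * kap * v2.
  by rewrite /kap /v2; field; rewrite !gt_eqF.
have u4 : 28 * a / (n%:R - 4) * m4 = 28 * (a * v4).
  by rewrite /v4; field; rewrite gt_eqF.
rewrite u1 u2 u3 u4.
have kv : 0 <= kap * v2 by rewrite mulr_ge0// ltW.
have ln : 0 <= lam / n%:R by rewrite divr_ge0// ltW.
rewrite /c7 -/a; lra.
Qed.
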